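(* Let $K$ be a field, $\mathbf f=(f_1,f_2):\{1,\dots,m\}\to\mathbb N^2$ with $f_1\equiv1$, and $M$ a finitely generated bigraded $K[\mathbf f]$-module. For $n\ge1$ let $M_{n,\bullet}=\bigoplus_{d\in\mathbb Z}M_{n,d}$, filtered by $\mathcal F_\lambda M_{n,\bullet}=\bigoplus_{d\ge\lambda}M_{n,d}$ ($\lambda\in\mathbb R$), and let $\nu_n=\nu_{M_{n,\bullet}}$. Then $(T_{1/n}\nu_n)_{n\ge1}$ converges vaguely to a Borel measure $\nu$ on $\mathbb R$. If moreover $M_{n,\bullet}\ne0$ for all sufficiently large $n$, then $\nu$ is a probability measure and the polygons $P(T_{1/n}\nu_n)$ converge uniformly on $[0,1]$ to a concave function.
   Context: $K[\mathbf f]$ is $K[T_1,\dots,T_m]$ graded by $\mathbb N^2$ with $T_i$ of bidegree $\mathbf f(i)$; a bigraded module is $M=\bigoplus_{(n,d)\in\mathbb Z^2}M_{n,d}$ compatible with this grading. For a nonzero finite-dimensional vector space $W$ with a separated, exhaustive, left continuous decreasing $\mathbb R$-filtration $(\mathcal F_rW)$, $\nu_W$ is the Borel probability measure with $\nu_W([r,+\infty[)=\dim\mathcal F_rW/\dim W$; for $W=0$, $\nu_W=0$. $T_\varepsilon\nu$ is the image of $\nu$ under $x\mapsto\varepsilon x$. Vague convergence: convergence of integrals of all continuous compactly supported functions. For a probability measure $\nu$ that is a finite combination of Dirac masses, with $F(x)=\nu(]x,+\infty[)$ and $F^*(t)=\sup\{x:F(x)>t\}$, $P(\nu)(t)=\int_0^tF^*(s)\,ds$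 on $[0,1]$. *)

(* Defs.v *)
From HB Require Import structures.
From mathcomp Require Import all_boot all_algebra.
From Stdlib Require Import Reals ZArith ClassicalEpsilon.
From Stdlib Require List.

Set Implicit Arguments.
Unset Strict Implicit.
Unset Printing Implicit Defensive.

Import GRing.Theory.

(* Part 1 : bigraded modules over K[f] = K[T_1..T_m], T_i of bidegree f i.
   A K[T_1..T_m]-module is a K-vector space V with m pairwise commuting
   K-linear endomorphisms T_i (the action of the variables).            *)

Section Module.
Local Open Scope ring_scope.
Variables (K : fieldType) (V : lmodType K).

Definition monomial (m : nat) (T : 'I_m -> V -> V) (e : 'I_m -> nat) (v : V) : V :=
  foldr (fun i w => ssrnat.iter (e i) (T i) w) v (enum 'I_m).

Definition is_subspace (S : V -> Prop) : Prop :=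
  S 0 /\ forall (a : K) (u w : V), S u -> S w -> S (a *: u + w).

Definition is_direct_sum_decomp (Mg : Z -> Z -> V -> Prop) : Prop :=
  (forall n d, is_subspace (Mg n d)) /\
  (forall v : V, exists s : seq ((Z * Z) * V)%type,
       List.Forall (fun t => Mg t.1.1 t.1.2 t.2) s /\ v = \sum_(t <- s) t.2) /\
  (forall s : seq ((Z * Z) * V)%type,
       List.NoDup (map fst s) -> List.Forall (fun t => Mg t.1.1 t.1.2 t.2) s ->
       \sum_(t <- s) t.2 = 0 -> List.Forall (fun t => t.2 = 0) s).

Definition is_bigraded_module (m : nat) (f : 'I_m -> nat * nat)
    (T : 'I_m -> V -> V) (Mg : Z -> Z -> V -> Prop) : Prop :=
  (forall i (a : K) (u w : V), T i (a *: u + w) = a *: T i u + T i w) /\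
  (forall i j (v : V), T i (T j v) = T j (T i v)) /\
  is_direct_sum_decomp Mg /\
  (forall i n d (v : V), Mg n d v ->
       Mg (n + Z.of_nat (f i).1)%Z (d + Z.of_nat (f i).2)%Z (T i v)).

Definition is_finitely_generated (m : nat) (T : 'I_m -> V -> V) : Prop :=
  exists gens : seq V, forall v : V,
    exists s : seq ((K * ('I_m -> nat)) * nat)%type,
      v = \sum_(t <- s) (t.1.1 *: monomial T t.1.2 (nth 0 gens t.2)).

Definition has_dim (S : V -> Prop) (k : nat) : Prop :=
  exists b : 'I_k -> V,
    (forall i, S (b i)) /\
    (forall c : 'I_k -> K, \sum_(i < k) c i *: b i = 0 -> forall i, c i = 0) /\
    (forall v, S v -> exists c : 'I_k -> K, v = \sum_(i < k) c i *: b i).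

Definition row_space (Mg : Z -> Z -> V -> Prop) (n : Z) (v : V) : Prop :=
  exists s : seq (Z * V)%type, List.Forall (fun t => Mg n t.1 t.2) s /\ v = \sum_(t <- s) t.2.

Definition filt_space (Mg : Z -> Z -> V -> Prop)
    (n : Z) (lam : R) (v : V) : Prop :=
  exists s : seq (Z * V)%type,
    List.Forall (fun t => Mg n t.1 t.2 /\ Rle lam (IZR t.1)) s /\ v = \sum_(t <- s) t.2.

End Module.

Local Open Scope R_scope.

Inductive is_borel : (R -> Prop) -> Prop :=
  | borel_open : forall A, open_set A -> is_borel A
  | borel_compl : forall A, is_borel A -> is_borel (fun x => ~ A x)
  | borel_union : forall A : nat -> R -> Prop,
      (forall k, is_borel (A k)) -> is_borel (fun x => exists k, A k x).

Definition borel_measure (mu : (R -> Prop) -> R) : Prop :=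
  (forall A, is_borel A -> 0 <= mu A) /\
  mu (fun _ => False) = 0 /\
  (forall A : nat -> R -> Prop,
     (forall k, is_borel (A k)) ->
     (forall i j x, i <> j -> A i x -> A j x -> False) ->
     infinite_sum (fun k => mu (A k)) (mu (fun x => exists k, A k x))).

Definition probability_measure (mu : (R -> Prop) -> R) : Prop :=
  borel_measure mu /\ mu (fun _ => True) = 1.

Definition indic (A : R -> Prop) (x : R) : R :=
  if excluded_middle_informative (A x) then 1 else 0.

Definition simple_eval (s : seq (R * (R -> Prop))) (x : R) : R :=
  List.fold_right (fun p acc => fst p * indic (snd p) x + acc) 0 s.
Definition simple_val (mu : (R -> Prop) -> R) (s : seq (R * (R -> Prop))) : R :=
  List.fold_right (fun p acc => fst p * mu (snd p) + acc) 0 s.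

Definition nn_integral (mu : (R -> Prop) -> R) (g : R -> R) (I : R) : Prop :=
  is_lub (fun v => exists s : seq (R * (R -> Prop)),
            List.Forall (fun p => 0 <= fst p /\ is_borel (snd p)) s /\
            (forall x, simple_eval s x <= g x) /\ v = simple_val mu s) I.

Definition integral (mu : (R -> Prop) -> R) (phi : R -> R) (v : R) : Prop :=
  exists I1 I2, nn_integral mu (fun x => Rmax (phi x) 0) I1 /\
                nn_integral mu (fun x => Rmax (- phi x) 0) I2 /\ v = I1 - I2.

Definition cont_compact_support (phi : R -> R) : Prop :=
  continuity phi /\ exists B, forall x, B < Rabs x -> phi x = 0.

Definition vague_cv (mus : nat -> (R -> Prop) -> R) (mu : (R -> Prop) -> R) : Prop :=
  forall phi, cont_compact_support phi ->
    exists v, integral mu phi v /\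
      exists vs : nat -> R, (forall k, integral (mus k) phi (vs k)) /\ Un_cv vs v.

Definition Tscale (eps : R) (nu : (R -> Prop) -> R) : (R -> Prop) -> R :=
  fun A => nu (fun x => A (eps * x)).

Definition nu_of (K : fieldType) (V : lmodType K) (Mg : Z -> Z -> V -> Prop)
    (n : Z) (mu : (R -> Prop) -> R) : Prop :=
  exists w : nat, has_dim (row_space Mg n) w /\
   (w = 0%nat -> forall A, mu A = 0) /\
   (w <> 0%nat -> probability_measure mu /\
      forall r k, has_dim (filt_space Mg n r) k ->
        mu (fun x => r <= x) = INR k / INR w).

Definition Rsup (E : R -> Prop) : R :=
  match excluded_middle_informative (exists l, is_lub E l) with
  | left H => proj1_sig (constructive_indefinite_description _ H)
  | right _ => 0
  end.

Definition RInt (f : R -> R) (a b : R) : R :=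
  match excluded_middle_informative (exists _ : Riemann_integrable f a b, True) with
  | left H => RiemannInt (proj1_sig (constructive_indefinite_description _ H))
  | right _ => 0
  end.

Definition tailF (nu : (R -> Prop) -> R) (x : R) : R := nu (fun y => x < y).
Definition Fstar (nu : (R -> Prop) -> R) (t : R) : R :=
  Rsup (fun x => tailF nu x > t).
Definition polygon (nu : (R -> Prop) -> R) (t : R) : R := RInt (Fstar nu) 0 t.

Definition concave_on01 (g : R -> R) : Prop :=
  forall x y l, 0 <= x <= 1 -> 0 <= y <= 1 -> 0 <= l <= 1 ->
    l * g x + (1 - l) * g y <= g (l * x + (1 - l) * y).

(* Main.v *)
Require Import Defs.
From Stdlib Require Import Reals ZArith Lia Lra ClassicalEpsilon.
From Stdlib Require List.
From mathcomp Require Import all_boot all_order all_algebra.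
From mathcomp Require Import zify ssrZ boolp Rstruct.
From Coquelicot Require Coquelicot.
From mathcomp Require all_classical all_reals all_analysis measurable_realfun.

(** Fix homogeneous generators and order the monomials [T^al g_j]
    lexicographically.  The standard monomials (those not in the span of the
    smaller ones of the same bidegree) form bases of the pieces [M_(n,d)], and
    for fixed [j] their exponents form a down-set of [N^m].  Hence [nu_n] is the
    empirical measure of the list of degrees of the standard monomials, and
    slicing down-sets (decreasing chains of which are stationary) shows that
    every power sum of these degrees is eventually polynomial in [n].  After
    rescaling, each moment is a bounded quotient of polynomials in [n], so it
    converges; by the Weierstrass approximation theorem the integrals of all
    continuous functions converge.  If the dimension polynomial vanishes, the
    limit is [0].  Otherwise the quantile functions of the measures converge off
    a countable set to a nonincreasing function, and the limit measure is the
    image under it of Lebesgue measure on the unit interval.  Finally, the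
    polygon of an empirical measure at [t] is the minimum over [c] of
    [c t + mean (x - c)_+], so the uniform convergence of these means for
    bounded [c] gives that of the polygons. *)

Set Implicit Arguments.
Unset Strict Implicit.
Unset Printing Implicit Defensive.

Import Order.TTheory GRing.Theory Num.Theory.
Local Open Scope ring_scope.
(* [%Z] denotes MathComp's [int_scope] here. *)
Delimit Scope Z_scope with BZ.

(** The degrees of the polynomials giving the power sums are never computed. Instead, since
    $f_1\equiv1$, the exponents in row n sum to n minus the degree of a generator, so the degrees in
    row n are bounded by C n. The k-th rescaled moment is then at most C^k, and this boundedness
    alone forces the quotient of polynomials to converge. The measures of nonzero rows are abstract
    probability measures prescribed on closed rays only; they must first be identified, on all Borel
    sets, with empirical measures. Limits of integrals only yield a positive functional: writing the
    limit as an image of Lebesgue measure reduces its countable additivity to that of Lebesgue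
    measure, and the integrals converge by dominated convergence along the quantile functions. The
    exceptional points are jumps of a monotone function, hence countable. The polygons need no
    quantile limits: (x - c)_+ is 1-Lipschitz in c, so a finite net of values of c reduces
    uniformity to finitely many limits. *)

Section SeqConversions.

Lemma Forall_inP (A : eqType) (P : A -> Prop) (s : seq A) :
  List.Forall P s <-> {in s, forall x, P x}.
Proof.
elim: s => [|x s IH]; first by split=> // _; exact: List.Forall_nil.
split=> [H|H].
  inversion H; subst => y; rewrite inE => /predU1P[->//|]; exact: (proj1 IH).
apply: List.Forall_cons; first by apply: H; rewrite inE eqxx.
by apply/IH => y ys; apply: H; rewrite inE ys orbT.
Qed.

Lemma uniq_NoDup (A : eqType) (s : seq A) : uniq s -> List.NoDup s.
Proof.
elim: s => [_|x s IH /= /andP[xs us]]; first exact: List.NoDup_nil.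
apply: List.NoDup_cons; last exact: IH.
move=> H; case/negP: xs; elim: s H {IH us} => //= y s IH [->|/IH]; rewrite inE.
  by rewrite eqxx.
by move=> ->; rewrite orbT.
Qed.

End SeqConversions.

(** * Dimensions of spans, by greedy extraction of a basis *)

Section Dimension.
Variables (K : fieldType) (V : lmodType K).

(** Expanding each family in the other gives matrices whose product is the identity of size [k], so
    [k] is at most the inner size [k'] by rank. *)
Lemma has_dim_leq (S : V -> Prop) (k k' : nat) :
  has_dim S k -> has_dim S k' -> (k <= k')%N.
Proof.
move=> [b [Sb [fb gb]]] [b' [Sb' [fb' gb']]].
have /choice[A HA] : forall i, exists c : 'I_k' -> K, b i = \sum_(j < k') c j *: b' j.
  by move=> i; exact: gb'.
have /choice[B HB] : forall i, exists c : 'I_k -> K, b' i = \sum_(j < k) c j *: b j.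
  by move=> i; exact: gb.
pose MA := \matrix_(i, j) A i j; pose MB := \matrix_(i, j) B i j.
apply: (@mulmx1_min _ _ _ MA MB); apply/matrixP => i l.
rewrite !mxE.
have : \sum_(l < k) ((\sum_(j < k') A i j * B j l) - (i == l)%:R) *: b l = 0.
  under eq_bigr do rewrite scalerBl scaler_suml.
  rewrite sumrB exchange_big /=.
  under eq_bigr => j _.
    under eq_bigr do rewrite -scalerA.
    rewrite -scaler_sumr -HB; over.
  rewrite -HA (bigD1 i) //= eqxx scale1r big1 ?addr0 ?subrr // => j ji.
  by rewrite eq_sym (negbTE ji) scale0r.
move=> /fb/(_ l)/eqP; rewrite subr_eq0 => /eqP <-.
by apply: eq_bigr => j _; rewrite !mxE.
Qed.

Lemma has_dim_uniq (S : V -> Prop) (k k' : nat) :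
  has_dim S k -> has_dim S k' -> k = k'.
Proof. by move=> h h'; apply/eqP; rewrite eqn_leq !(has_dim_leq (S := S)). Qed.

Lemma has_dim_ext (S S' : V -> Prop) (k : nat) :
  (forall v, S v <-> S' v) -> has_dim S k -> has_dim S' k.
Proof.
move=> SS' [b [Sb [fb gb]]]; exists b; split; last split=> //.
  by move=> i; apply/SS'.
by move=> v /SS'; exact: gb.
Qed.

(** The witness is a finite list of weighted indices, repetitions allowed, so that adding vectors is
    concatenating lists. *)
Definition gspan (I : eqType) (g : I -> V) (P : I -> Prop) (v : V) : Prop :=
  exists2 s : seq (K * I), {in s, forall t, P t.2} & v = \sum_(t <- s) t.1 *: g t.2.

Section Gspan.
Variables (I : eqType) (g : I -> V).

Lemma gspan0 P : gspan g P 0.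
Proof. by exists [::] => //; rewrite big_nil. Qed.

Lemma gspanD P u v : gspan g P u -> gspan g P v -> gspan g P (u + v).
Proof.
move=> [s sP ->] [s' s'P ->]; exists (s ++ s'); last by rewrite big_cat.
by move=> t; rewrite mem_cat => /orP[/sP|/s'P].
Qed.

Lemma gspanZ P a v : gspan g P v -> gspan g P (a *: v).
Proof.
move=> [s sP ->]; exists [seq (a * t.1, t.2) | t <- s].
  by move=> _ /mapP[t /sP ? ->].
by rewrite big_map scaler_sumr; apply: eq_bigr => t _; rewrite scalerA.
Qed.

Lemma gspan_mem (P : I -> Prop) i : P i -> gspan g P (g i).
Proof.
move=> Pi; exists [:: (1, i)]; first by move=> t; rewrite inE => /eqP ->.
by rewrite big_seq1 scale1r.
Qed.

Lemma gspan_sum (P : I -> Prop) (J : eqType) (s : seq J) (F : J -> V) :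
  {in s, forall j, gspan g P (F j)} -> gspan g P (\sum_(j <- s) F j).
Proof.
elim: s => [|j s IH] H; first by rewrite big_nil; exact: gspan0.
rewrite big_cons; apply: gspanD; first by apply: H; rewrite inE eqxx.
by apply: IH => i si; apply: H; rewrite inE si orbT.
Qed.

Lemma gspan_mono (P Q : I -> Prop) v :
  (forall i, P i -> Q i) -> gspan g P v -> gspan g Q v.
Proof. by move=> PQ [s sP ->]; exists s => // t /sP /PQ. Qed.

Lemma gspan_seq_nil v : gspan g (fun i => i \in [::]) v -> v = 0.
Proof.
move=> [s sP ->]; case: s sP => [|t s] sP; first by rewrite big_nil.
by have := sP t (mem_head t s).
Qed.

Lemma gspan_cons (x : I) (l : seq I) v :
  gspan g (fun i => i \in x :: l) v <->
  exists a, gspan g (fun i => i \in l) (v - a *: g x).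
Proof.
split=> [[s sP ->]|[a H]]; last first.
  rewrite -(subrK (a *: g x) v); apply: gspanD.
    by apply: gspan_mono H => i il; rewrite inE il orbT.
  by apply/gspanZ/gspan_mem; rewrite inE eqxx.
elim: s sP => [|t s IH] sP.
  by exists 0; rewrite big_nil scale0r subr0; exact: gspan0.
have [|a Ha] := IH; first by move=> u su; apply: sP; rewrite inE su orbT.
have := sP t (mem_head t s); rewrite inE => /predU1P[tx|tl].
  by exists (t.1 + a); rewrite big_cons tx scalerDl opprD addrACA subrr add0r.
by exists a; rewrite big_cons -addrA; apply: gspanD => //; apply/gspanZ/gspan_mem.
Qed.

Lemma has_dim_gspan_cons_dep (x : I) (l : seq I) k :
  gspan g (fun i => i \in l) (g x) ->
  has_dim (gspan g (fun i => i \in l)) k ->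
  has_dim (gspan g (fun i => i \in x :: l)) k.
Proof.
move=> gx; apply: has_dim_ext => v; split=> [|/gspan_cons[a]].
  by apply: gspan_mono => i il; rewrite inE il orbT.
by move=> H; rewrite -(subrK (a *: g x) v); apply: gspanD => //; apply: gspanZ.
Qed.

Lemma has_dim_gspan_cons_free (x : I) (l : seq I) k :
  ~ gspan g (fun i => i \in l) (g x) ->
  has_dim (gspan g (fun i => i \in l)) k ->
  has_dim (gspan g (fun i => i \in x :: l)) k.+1.
Proof.
move=> gx [b [Sb [fb gb]]].
exists (fun i => if unlift ord0 i is Some j then b j else g x); split; last split.
- move=> i; case: unliftP => [j _|_]; last by apply: gspan_mem; rewrite inE eqxx.
  by apply: gspan_mono (Sb j) => y yl; rewrite inE yl orbT.
- move=> c; rewrite big_ord_recl unlift_none.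
  under eq_bigr do rewrite liftK.
  move=> H.
  have c0 : c ord0 = 0.
    apply: contra_notP gx => /eqP c0.
    rewrite -(scale1r (g x)) -(mulVf c0) -scalerA; apply: gspanZ.
    move/eqP: H; rewrite addr_eq0 => /eqP ->; rewrite -sumrN.
    by apply: gspan_sum => j _; rewrite -scaleNr; apply: gspanZ.
  move: H; rewrite c0 scale0r add0r => /fb H i.
  by case: (unliftP ord0 i) => [j ->|->].
- move=> v /gspan_cons[a] /gb[c Hc].
  exists (fun i => if unlift ord0 i is Some j then c j else a).
  rewrite big_ord_recl unlift_none.
  under eq_bigr do rewrite !liftK.
  by rewrite -Hc addrC subrK.
Qed.

Lemma has_dim_gspan_nil : has_dim (gspan g (fun i => i \in [::])) 0.
Proof.
exists (fun=> 0); split=> [i|]; first by exact: gspan0.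
split=> [c _ []//|v /gspan_seq_nil ->].
by exists (fun=> 0); rewrite big_ord0.
Qed.

End Gspan.
End Dimension.

(** * Homogeneous components *)

Section Homogeneous.
Variables (K : fieldType) (V : lmodType K) (Mg : Z -> Z -> V -> Prop).
Hypothesis HMg : is_direct_sum_decomp Mg.

Definition homog (t : (Z * Z) * V) : Prop := Mg t.1.1 t.1.2 t.2.

Lemma Mg_sum n d (J : eqType) (s : seq J) (F : J -> V) :
  {in s, forall j, Mg n d (F j)} -> Mg n d (\sum_(j <- s) F j).
Proof.
have [/(_ n d)[S0 SL] _] := HMg.
elim: s => [|j s IH] H; first by rewrite big_nil.
rewrite big_cons -[F j]scale1r; apply: SL; first by apply: H; rewrite inE eqxx.
by apply: IH => i si; apply: H; rewrite inE si orbT.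
Qed.

Lemma MgZ n d a v : Mg n d v -> Mg n d (a *: v).
Proof.
have [/(_ n d)[S0 SL] _] := HMg.
by move=> Hv; rewrite -[_ *: _]addr0; apply: SL.
Qed.

(** Directness speaks only of lists with pairwise distinct bidegrees, so summands of equal bidegree
    are collected: [s'] has one entry per bidegree occurring in [s]. *)
Lemma homog_component0 (s : seq ((Z * Z) * V)) (k : Z * Z) :
  {in s, forall t, homog t} -> \sum_(t <- s) t.2 = 0 ->
  \sum_(t <- s | t.1 == k) t.2 = 0.
Proof.
move=> sH s0; pose keys := undup (map fst s).
have [kk|kk] := boolP (k \in keys); last first.
  rewrite big_seq_cond big1 // => t /andP[ts /eqP tk].
  by case/negP: kk; rewrite mem_undup -tk; apply: map_f.
pose s' := [seq (k, \sum_(t <- s | t.1 == k) t.2) | k <- keys].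
have /Forall_inP Hs' : List.Forall (fun t => t.2 = 0) s'.
  have [_ [_]] := HMg; apply.
  - have <- : keys = map fst s' by rewrite -map_comp map_id_in.
    by apply: uniq_NoDup; exact: undup_uniq.
  - apply/Forall_inP => _ /mapP[l lk ->] /=.
    rewrite -big_filter; apply: Mg_sum => t; rewrite mem_filter => /andP[/eqP <-].
    exact: sH.
  - rewrite big_map /= (exchange_big_dep predT) //= -[RHS]s0.
    rewrite [RHS]big_seq [LHS]big_seq; apply: eq_bigr => t ts.
    under eq_bigl do rewrite eq_sym.
    rewrite -big_filter (_ : filter _ _ = [:: t.1]) ?big_seq1 //.
    apply: filter_pred1_uniq; first exact: undup_uniq.
    by rewrite mem_undup; apply: map_f.
exact: (Hs' (k, _) (map_f _ kk)).
Qed.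

Lemma homog_component (s : seq ((Z * Z) * V)) (n d : Z) (v : V) :
  {in s, forall t, homog t} -> Mg n d v -> v = \sum_(t <- s) t.2 ->
  v = \sum_(t <- s | t.1 == (n, d)) t.2.
Proof.
move=> sH Hv vs.
(* Moving [v] to the other side turns the claim into the vanishing of one component of a zero
   sum. *)
have := @homog_component0 (((n, d), - v) :: s) (n, d).
rewrite !big_cons /= eqxx -vs addNr => H; apply/eqP; rewrite eq_sym -subr_eq0 addrC.
apply/eqP; apply: H => // t; rewrite inE => /predU1P[->|/sH//].
by rewrite /homog /= -scaleN1r; apply: MgZ.
Qed.

(** Justifies comparing a monomial only with others of the same bidegree: in a relation for a
    homogeneous vector, the terms of the remaining bidegrees cancel among themselves. *)
Lemma gspan_component (I : eqType) (g : I -> V) (deg : I -> Z * Z)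
    (P : I -> Prop) n d v :
  (forall i, P i -> homog (deg i, g i)) -> Mg n d v ->
  gspan g P v -> gspan g (fun i => P i /\ deg i = (n, d)) v.
Proof.
move=> gH Hv [s sP vE].
have := @homog_component [seq (deg t.2, t.1 *: g t.2) | t <- s] n d v.
rewrite !big_map /= => -> //; last first.
  by move=> _ /mapP[t ts ->]; apply: MgZ; apply: gH; apply: sP.
exists [seq t <- s | deg t.2 == (n, d)]; last by rewrite big_filter.
by move=> t; rewrite mem_filter => /andP[/eqP ? /sP].
Qed.

End Homogeneous.

(** * Eventually polynomial functions and the difference operator *)

Section EventuallyPolynomial.
Variable F : numFieldType.

Definition evpoly (g : nat -> F) : Prop :=
  exists p : {poly F}, exists N, forall n, (N <= n)%N -> g n = p.[n%:R].

Lemma evpoly_eventually (g h : nat -> F) N :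
  (forall n, (N <= n)%N -> g n = h n) -> evpoly h -> evpoly g.
Proof.
move=> gh [p [M hp]]; exists p, (maxn N M) => n; rewrite geq_max => /andP[Nn Mn].
by rewrite gh // hp.
Qed.

Lemma evpolyD (g h : nat -> F) :
  evpoly g -> evpoly h -> evpoly (fun n => g n + h n).
Proof.
move=> [p [M hp]] [q [N hq]]; exists (p + q), (maxn M N) => n.
by rewrite geq_max => /andP[Mn Nn]; rewrite hornerD hp // hq.
Qed.

Lemma evpoly_sum (J : Type) (s : seq J) (g : J -> nat -> F) :
  (forall j, evpoly (g j)) -> evpoly (fun n => \sum_(j <- s) g j n).
Proof.
move=> gH; elim: s => [|j s IH].
  by exists 0, 0%N => n _; rewrite big_nil horner0.
by under eq_fun do rewrite big_cons; apply: evpolyD.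
Qed.

Lemma evpoly_addn (h : nat -> F) a : evpoly h -> evpoly (fun n => h (n + a)%N).
Proof.
move=> [p [M hp]]; exists (p \Po ('X + a%:R%:P)), M => n Hn.
by rewrite hp ?horner_comp ?hornerE ?natrD // (leq_trans Hn) // leq_addr.
Qed.

Lemma evpoly_subn (h : nat -> F) a : evpoly h -> evpoly (fun n => h (n - a)%N).
Proof.
move=> [p [M hp]]; exists (p \Po ('X - a%:R%:P)), (M + a)%N => n Hn.
by rewrite hp ?horner_comp ?hornerE ?natrB //; lia.
Qed.

Lemma evpoly_succ (h : nat -> F) : evpoly h -> evpoly (fun n => h n.+1).
Proof. by move=> /(@evpoly_addn _ 1); under eq_fun do rewrite addn1. Qed.

Lemma evpoly_pred (h : nat -> F) : evpoly (fun n => h n.+1) -> evpoly h.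
Proof.
move=> /(@evpoly_subn _ 1); apply: (evpoly_eventually (N := 1)) => n n1.
by rewrite subn1 prednK.
Qed.

Lemma coef_XD1_exp n j : (('X + 1 : {poly F}) ^+ n)`_j = 'C(n, j)%:R.
Proof.
elim: n j => [|n IH] j; first by rewrite expr0 coef1 bin0n; case: j.
rewrite exprS mulrDl mul1r coefD coefXM; case: j => [|j] /=.
  by rewrite add0r IH !bin0.
by rewrite !IH binS natrD addrC.
Qed.

(** The difference of X^(d+1) has leading term (d+1) X^d, and d+1 is invertible in characteristic 0;
    subtracting the right multiple lowers the degree of [q]. *)
Lemma poly_difference_surjective (q : {poly F}) :
  exists Q : {poly F}, Q \Po ('X + 1) - Q = q.
Proof.
have [d] := ubnP (size q); elim: d q => // d IH q; rewrite ltnS => qd.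
case: d IH qd => [_|d IH qd].
  by rewrite leqn0 size_poly_eq0 => /eqP ->; exists 0; rewrite comp_poly0 subrr.
pose c := q`_d / d.+1%:R.
pose Q1 : {poly F} := c *: 'X^(d.+1).
have Q1E j : (Q1 \Po ('X + 1) - Q1)`_j = c * ('C(d.+1, j)%:R - (j == d.+1)%:R).
  by rewrite comp_polyZ comp_Xn_poly -scalerBr coefZ coefB coef_XD1_exp coefXn.
have [|Q2 HQ2] := IH (q - (Q1 \Po ('X + 1) - Q1)).
  rewrite ltnS; apply/leq_sizeP => j dj; rewrite coefB Q1E.
  have [->|jd] := eqVneq j d.
    by rewrite binSn ltn_eqF // subr0 /c divfK ?subrr // pnatr_eq0.
  have dj' : (d < j)%N by rewrite ltn_neqAle eq_sym jd.
  have -> : q`_j = 0 by apply/leq_sizeP/dj'/qd.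
  have [->|jd'] := eqVneq j d.+1; first by rewrite binn subrr mulr0 subr0.
  by rewrite bin_small ?subr0 ?mulr0 ?subr0 // ltn_neqAle eq_sym jd'.
by exists (Q1 + Q2); rewrite comp_polyD opprD addrACA HQ2 addrC subrK.
Qed.

Lemma evpoly_difference (g : nat -> F) :
  evpoly (fun n => g n.+1 - g n) -> evpoly g.
Proof.
move=> [q [N hq]]; have [Q HQ] := poly_difference_surjective q.
(* The constant makes the discrete antiderivative agree with [g] at [N]. *)
exists (Q + (g N - Q.[N%:R])%:P), N => n /subnK <-.
elim: (n - N)%N => [|k IH]; first by rewrite add0n hornerD hornerC addrC subrK.
rewrite addSn -(subrK (g (k + N)%N) (g _)) hq ?leq_addl // {}IH -HQ.
by rewrite !(hornerD, hornerN, horner_comp, hornerC, hornerX) -natr1 addrA subrK.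
Qed.

End EventuallyPolynomial.

(** * Weighted sums over down-sets of exponent vectors *)

Section Compositions.

Fixpoint compositions (m n : nat) : seq (seq nat) :=
  if m is m'.+1 then
    flatten [seq map (cons a) (compositions m' (n - a)) | a <- iota 0 n.+1]
  else if n == 0 then [:: [::]] else [::].

Fixpoint weight (fs al : seq nat) : nat :=
  match fs, al with
  | f :: fs', a :: al' => f * a + weight fs' al'
  | _, _ => 0
  end%N.

Lemma compositionsS m n : compositions m.+1 n =
  flatten [seq map (cons a) (compositions m (n - a)) | a <- iota 0 n.+1].
Proof. by []. Qed.

Lemma mem_compositions m n al :
  (al \in compositions m n) = (size al == m) && (sumn al == n).
Proof.
elim: m n al => [|m IH] n al; first by case: al => [|a al]; case: n.
rewrite compositionsS.
apply/flatten_mapP/andP => [[a]|[]].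
  rewrite mem_iota add0n ltnS => an /mapP[be]; rewrite IH => /andP[/eqP <- /eqP s] ->.
  by rewrite /= s; split=> //; apply/eqP; lia.
case: al => // a be; rewrite [size _]/= eqSS => /eqP sb /eqP <-.
exists a; first by rewrite mem_iota /=; lia.
by apply: map_f; rewrite IH sb eqxx /=; apply/eqP; lia.
Qed.

Lemma compositions_uniq m n : uniq (compositions m n).
Proof.
elim: m n => [|m IH] n; first by rewrite /=; case: eqP.
rewrite compositionsS.
elim: (iota _ _) (iota_uniq 0 n.+1) => //= a s IHs /andP[as_ us].
rewrite cat_uniq IHs // map_inj_uniq ?IH //=; last by move=> ? ? [].
rewrite andbT; apply/hasPn => al /flatten_mapP[b bs /mapP[be _ ->]].
apply/mapP => -[ga _ [ba _]]; case/negP: as_; by rewrite -ba.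
Qed.

(** Either the first exponent is 0, or the monomial is divisible by the first variable, which is
    divided out. This is the recursion in [n] behind [wsum_recl]. *)
Lemma compositions_recl m n : compositions m.+1 n.+1 =
  map (cons 0%N) (compositions m n.+1) ++
  map (fun al => incr_nth al 0) (compositions m.+1 n).
Proof.
rewrite [LHS]compositionsS -[n.+2]add1n iotaD map_cat flatten_cat.
congr (_ ++ _); first by rewrite /= cats0.
rewrite compositionsS map_flatten -(addn0 (0 + 1)%N) iotaDl -!map_comp.
congr flatten; apply: eq_map => a.
by rewrite /= -map_comp add0n add1n subSS; apply: eq_map.
Qed.

(** Closure under divisors of monomials, one variable at a time, to match the action of a single
    [T i]. *)
Definition downset (m : nat) (D : pred (seq nat)) : Prop :=
  forall al i, size al = m -> (i < m)%N -> D (incr_nth al i) -> D al.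

Lemma downset_slice m (D : pred (seq nat)) a :
  downset m.+1 D -> downset m (fun be => D (a :: be)).
Proof. by move=> DD al i sa im; apply: (DD (a :: al) i.+1) => //=; rewrite sa. Qed.

Lemma slice_decreasing m (D : pred (seq nat)) a b be :
  downset m.+1 D -> size be = m -> (a <= b)%N -> D (b :: be) -> D (a :: be).
Proof.
move=> DD sb; elim: b => [|b IH]; first by rewrite leqn0 => /eqP ->.
rewrite leq_eqVlt => /predU1P[->//|]; rewrite ltnS => /IH {}IH Db; apply: IH.
by apply: (DD (b :: be) 0%N) => //=; rewrite sb.
Qed.

(** A form of Dickson's lemma, by induction on the number of variables. The diagonal slices
    [D a (a :: be)] are again a decreasing chain, stationary from some [A]. This settles all first
    exponents at least [A]; each of the finitely many smaller ones gives a decreasing chain in fewer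
    variables. *)
Lemma downset_chain_stationary m (D : nat -> pred (seq nat)) :
  (forall a, downset m (D a)) ->
  (forall a b al, size al = m -> (a <= b)%N -> D b al -> D a al) ->
  exists A, forall a al, size al = m -> (A <= a)%N -> D a al = D A al.
Proof.
elim: m D => [|m IH] D DD Ddec.
  have [[A HA]|H] := pselect (exists a, ~~ D a [::]).
    exists A => a [] // _ Aa; rewrite (negbTE HA); apply/negbTE.
    by apply: contra HA; apply: Ddec.
  exists 0%N => a [] // _ _.
  have D1 b : D b [::] by apply: contrapT => /negP Hb; apply: H; exists b.
  by rewrite !D1.
have [|a b al sa ab|A HA] := IH (fun a be => D a (a :: be)).
- by move=> a; apply: downset_slice.
- move=> Db; apply: (slice_decreasing (DD a) sa ab).
  by apply: Ddec ab Db; rewrite /= sa.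
(* With M = max(a, b), membership at (M, M) implies membership at (a, b), which implies membership
   at (A, A), and the two ends agree. *)
have {}HA a b be : size be = m -> (A <= a)%N -> (A <= b)%N ->
    D a (b :: be) = D A (A :: be).
  move=> sb Aa Ab; apply/idP/idP => H.
    apply: (slice_decreasing (DD A) sb Ab); apply: Ddec Aa H; by rewrite /= sb.
  have := HA (maxn a b) be sb; rewrite leq_max Aa => /(_ isT) Hm.
  move: H; rewrite -Hm => H.
  apply: (slice_decreasing (DD a) sb (leq_maxr a b)).
  by apply: Ddec (leq_maxl a b) H; rewrite /= sb.
have /choice[B HB] : forall b, exists B, forall a be, size be = m -> (B <= a)%N ->
    D a (b :: be) = D B (b :: be).
  move=> b; apply: (IH (fun a be => D a (b :: be))) => [a|a a' al sa].
    exact: downset_slice.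
  by apply: Ddec; rewrite /= sa.
exists (maxn A (\max_(b < A) B b)) => a [//|b be] [sb].
rewrite geq_max => /andP[Aa Ba].
have [Ab|bA] := leqP A b; first by rewrite !HA // leq_maxl.
have BB := leq_bigmax (F := fun b : 'I_A => B b) (Ordinal bA).
rewrite /= in BB; rewrite HB //; last exact: leq_trans BB Ba.
by rewrite [RHS]HB // (leq_trans BB) // leq_maxr.
Qed.

Variable F : numFieldType.

(** For the standard exponents over one generator of second degree d and p = (X + d)^k, this is the
    share of that generator in the k-th power sum of the degrees. *)
Definition wsum (fs : seq nat) (D : pred (seq nat)) (p : {poly F}) (m n : nat) : F :=
  \sum_(al <- compositions m n | D al) p.[(weight fs al)%:R].

(** Dividing out the first variable lowers the weight by [f0], which the translation of [p] makes up
    for. *)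
Lemma wsum_recl f0 fs D p m n :
  wsum (f0 :: fs) D p m.+1 n.+1 =
  wsum fs (fun be => D (0%N :: be)) p m n.+1 +
  wsum (f0 :: fs) (fun al => D (incr_nth al 0)) (p \Po ('X + f0%:R%:P)) m.+1 n.
Proof.
rewrite /wsum compositions_recl big_cat !big_map; congr (_ + _).
  by apply: eq_bigr => be _; rewrite /= muln0 add0n.
rewrite big_seq_cond [RHS]big_seq_cond; apply: eq_bigr => al.
rewrite mem_compositions => /andP[/andP[sa _] _].
case: al sa => // a be _ /=.
rewrite horner_comp !(hornerD, hornerX, hornerC) -natrD.
by congr (_.[_%:R]); lia.
Qed.

Lemma eq_wsum fs D D' p m n :
  (forall al, size al = m -> D al = D' al) -> wsum fs D p m n = wsum fs D' p m n.
Proof.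
move=> DD'; rewrite /wsum big_seq_cond [RHS]big_seq_cond; apply: eq_bigl => al.
rewrite mem_compositions; case: eqP => //= sa; by rewrite DD'.
Qed.

Lemma size_comp_XaddC_sub (p : {poly F}) c :
  p != 0 -> (size (p \Po ('X + c%:P) - p)%R < size p)%N.
Proof.
move=> p0; have sz : size (p \Po ('X + c%:P)) = size p.
  by rewrite size_comp_poly2 // size_XaddC.
have lc : lead_coef (p \Po ('X + c%:P)) = lead_coef p.
  by rewrite lead_coef_comp ?size_XaddC // lead_coefXaddC expr1n mulr1.
have sp : (0 < size p)%N by rewrite size_poly_gt0.
rewrite -(prednK sp) ltnS; apply/leq_sizeP => j; rewrite leq_eqVlt coefB.
move=> /predU1P[<-|Hj].
  by move: lc; rewrite /lead_coef sz => ->; rewrite subrr.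
by rewrite !nth_default ?subrr ?sz // -(prednK sp).
Qed.

(** Three nested inductions: on the number of variables, on the rank [A] from which the slices of
    [D] are constant, and, once all slices coincide, on the size of [p]. In the last case the
    difference in [n] is a sum in fewer variables plus a sum for p(X + f0) - p, which is smaller
    than [p]. *)
Lemma evpoly_wsum m fs (D : pred (seq nat)) (p : {poly F}) :
  size fs = m -> downset m D -> evpoly (wsum fs D p m).
Proof.
elim: m fs D p => [|m IH] fs D p.
  move=> _ _; exists 0, 1%N => -[//|n] _.
  by rewrite /wsum big_nil horner0.
case: fs => // f0 fs [sf] DD.
have [|a b be sb ab|A HA] := @downset_chain_stationary m (fun a be => D (a :: be)).
- by move=> a; apply: downset_slice.
- exact: slice_decreasing DD sb ab.
elim: A D DD p HA => [|A IHA] D DD p HA.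
  have [k] := ubnP (size p); elim: k p => // k IHk p; rewrite ltnS => pk.
  have [->|p0] := eqVneq p 0.
    by exists 0, 0%N => n _; rewrite /wsum big1 ?horner0 // => al _; rewrite horner0.
  apply: evpoly_difference.
  have E n : wsum (f0 :: fs) D p m.+1 n.+1 - wsum (f0 :: fs) D p m.+1 n =
      wsum fs (fun be => D (0%N :: be)) p m n.+1 +
      wsum (f0 :: fs) D (p \Po ('X + f0%:R%:P) - p) m.+1 n.
    rewrite wsum_recl -addrA; congr (_ + _).
    (* For [A] equal to 0, membership does not depend on the first exponent. *)
    rewrite (@eq_wsum _ _ D); last first.
      by case=> // a be [sb] /=; rewrite HA // [RHS]HA.
    by rewrite /wsum -sumrB; apply: eq_bigr => al _; rewrite !hornerE.
  apply: (evpoly_eventually (N := 0)) => [n _|]; first exact: E.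
  apply: evpolyD; last by apply: IHk; apply: leq_trans pk; apply: size_comp_XaddC_sub.
  by apply/evpoly_succ/IH => //; apply: downset_slice.
(* Splitting off the slice at 0 leaves a translate of [D] whose slices are constant one rank
   earlier. *)
apply: evpoly_pred.
under eq_fun do rewrite wsum_recl.
apply: evpolyD.
  by apply/evpoly_succ/IH => //; apply: downset_slice.
apply: IHA => [[//|a al] i [sa] im /= |a be sb Aa /=]; last exact: HA.
case: i im => [|i] im /= H.
  by apply: (DD (a.+1 :: al) 0%N) => //=; rewrite sa.
by apply: (DD (a.+1 :: al) i.+1) => //=; rewrite sa.
Qed.

End Compositions.

(** * Lexicographic order and weights of exponents *)

Section Lexicographic.

Fixpoint lexlt (s t : seq nat) : bool :=
  match s, t with
  | _, [::] => false
  | [::], _ :: _ => true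
  | a :: s', b :: t' => (a < b)%N || ((a == b) && lexlt s' t')
  end.

Lemma lexlt_irr s : lexlt s s = false.
Proof. by elim: s => //= a s ->; rewrite ltnn eqxx. Qed.

Lemma lexlt_trans t s u : lexlt s t -> lexlt t u -> lexlt s u.
Proof.
elim: s t u => [|a s IH] [|b t] [|c u] //=.
case/orP=> [ab|/andP[/eqP -> st]]; case/orP=> [bc|/andP[/eqP <- tu]].
- by rewrite (ltn_trans ab bc).
- by rewrite ab.
- by rewrite bc.
- by rewrite eqxx (IH _ _ st tu) orbT.
Qed.

Lemma lexlt_total s t : s != t -> lexlt s t || lexlt t s.
Proof.
elim: s t => [|a s IH] [|b t] //=; rewrite eqseq_cons negb_and.
by case: (ltngtP a b) => //= _; exact: IH.
Qed.

(** The compatibility with multiplication by a variable required of a monomial order. *)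
Lemma lexlt_incr_nth s t k : size s = size t -> (k < size s)%N ->
  lexlt s t -> lexlt (incr_nth s k) (incr_nth t k).
Proof.
elim: s t k => [|a s IH] [|b t] [|k] //= [st].
rewrite ltnS => ks /orP[->//|/andP[-> /IH ->//]]; by rewrite orbT.
Qed.

Lemma flatten_map_uniq (A B : eqType) (G : A -> seq B) (key : B -> A) (s : seq A) :
  uniq s -> (forall a, uniq (G a)) -> (forall a x, x \in G a -> key x = a) ->
  uniq (flatten (map G s)).
Proof.
move=> us uG kG; elim: s us => //= a s IH /andP[as_ us].
rewrite cat_uniq uG IH //= andbT; apply/hasPn => x /flatten_mapP[b bs xb].
apply/negP => xa; case/negP: as_; by rewrite -(kG _ _ xa) (kG _ _ xb).
Qed.

Lemma weightE fs al : size al = size fs ->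
  weight fs al = (\sum_(i < size fs) nth 0 fs i * nth 0 al i)%N.
Proof.
elim: fs al => [|f fs IH] [|a al] //=; first by rewrite big_ord0.
by move=> [sa]; rewrite big_ord_recl /= IH.
Qed.

Lemma weight_leq fs al C : all (fun f => f <= C)%N fs ->
  (weight fs al <= C * sumn al)%N.
Proof.
elim: fs al => [|f fs IH] [|a al] //= /andP[fC fsC].
by rewrite mulnDr leq_add ?IH // leq_mul2r fC orbT.
Qed.

End Lexicographic.

(** A generator of first degree [z], possibly negative, meets row [n] in exponents of total degree n
    - z, and not at all when n < z. *)
Lemma evpoly_shiftZ (F : numFieldType) (h : nat -> F) (z : Z) : evpoly h ->
  evpoly (fun n => if (z <=? Z.of_nat n)%BZ then h (Z.to_nat (Z.of_nat n - z)) else 0).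
Proof.
move=> hH; have [z0|z0] := Z.leb_spec 0 z.
  apply: (evpoly_eventually (N := Z.to_nat z)) (evpoly_subn (Z.to_nat z) hH) => n zn.
  by rewrite ifT; [congr h|]; lia.
apply: (evpoly_eventually (N := 0)) (evpoly_addn (Z.to_nat (- z)) hH) => n zn.
by rewrite ifT; [congr h|]; lia.
Qed.

(** * Action of monomials on the graded pieces *)

Section Monomials.
Variables (K : fieldType) (V : lmodType K) (m : nat).
Variables (f : 'I_m -> nat * nat) (T : 'I_m -> V -> V) (Mg : Z -> Z -> V -> Prop).
Hypothesis HM : is_bigraded_module f T Mg.

Lemma T_linear i (a : K) u w : T i (a *: u + w) = a *: T i u + T i w.
Proof. by case: HM => + _; apply. Qed.

Lemma T0 i : T i 0 = 0.
Proof.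
have := T_linear i 1 0 0; rewrite !scale1r addr0 => /eqP.
by rewrite -subr_eq0 opprD addNKr oppr_eq0 => /eqP.
Qed.

Lemma TZ i a u : T i (a *: u) = a *: T i u.
Proof. by rewrite -[in LHS](addr0 (a *: u)) T_linear T0 addr0. Qed.

Lemma TD i u w : T i (u + w) = T i u + T i w.
Proof. by rewrite -[in LHS](scale1r u) T_linear scale1r. Qed.

Lemma T_sum i (J : Type) (s : seq J) (G : J -> V) :
  T i (\sum_(j <- s) G j) = \sum_(j <- s) T i (G j).
Proof. exact: (big_morph (T i) (TD i) (T0 i)). Qed.

Lemma T_iter i j e v : T i (ssrnat.iter e (T j) v) = ssrnat.iter e (T j) (T i v).
Proof. by elim: e => //= e <-; have [_ [+ _]] := HM; apply. Qed.

Lemma eq_monomial e e' v : e =1 e' -> monomial T e v = monomial T e' v.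
Proof. by move=> ee'; rewrite /monomial; elim: (enum _) => //= i s ->; rewrite ee'. Qed.

Lemma monomial_sum e (J : Type) (s : seq J) (G : J -> V) :
  monomial T e (\sum_(j <- s) G j) = \sum_(j <- s) monomial T e (G j).
Proof.
rewrite /monomial; elim: (enum _) => //= i l ->.
by elim: (e i) => //= k ->; rewrite T_sum.
Qed.

Lemma monomial0 e : monomial T e 0 = 0.
Proof.
rewrite /monomial; elim: (enum _) => //= i l ->.
by elim: (e i) => //= k ->; rewrite T0.
Qed.

(** The variables commute, so [T k] can be moved inwards to its own power. *)
Lemma T_monomial k e v :
  T k (monomial T e v) = monomial T (fun i => (i == k) + e i)%N v.
Proof.
rewrite /monomial.
have: k \in enum 'I_m by rewrite mem_enum.
elim: (enum _) (enum_uniq 'I_m) => //= i l IH /andP[il ul]; rewrite inE.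
have [E _|ki /=] := eqVneq k i; last first.
  by move=> kl; rewrite add0n T_iter IH.
rewrite -E in il *; rewrite add1n iterS; congr (T _ (ssrnat.iter _ _ _)).
elim: l il {IH ul} => //= j l IH; rewrite inE negb_or => /andP[kj /IH ->].
by rewrite eq_sym (negbTE kj).
Qed.

Lemma monomial_homog e n d v : Mg n d v ->
  Mg (n + Z.of_nat (\sum_(i < m) (f i).1 * e i))
     (d + Z.of_nat (\sum_(i < m) (f i).2 * e i)) (monomial T e v).
Proof.
move=> Hv; rewrite /monomial -!big_enum /=.
elim: (enum _) => [|i l IH] /=; first by rewrite !big_nil !Z.add_0_r.
rewrite !big_cons; elim: (e i) => [|k IHk] /=; first by rewrite !muln0 !add0n.
have [_ [_ [_ /(_ i _ _ _ IHk)]]] := HM.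
by congr Mg; rewrite !mulnS; lia.
Qed.

End Monomials.

(** * Standard monomials and bases of the graded pieces *)

Section StandardMonomials.
Variables (K : fieldType) (V : lmodType K) (m : nat).
Variables (f : 'I_m -> nat * nat) (T : 'I_m -> V -> V) (Mg : Z -> Z -> V -> Prop).
Hypothesis Hf1 : forall i, (f i).1 = 1%N.
Hypothesis HM : is_bigraded_module f T Mg.
Variable hg : seq ((Z * Z) * V).
Hypothesis hgH : {in hg, forall t, homog Mg t}.

Let gen (j : nat) : (Z * Z) * V := nth ((0%BZ, 0%BZ), 0) hg j.
Let fs : seq nat := [seq (f i).2 | i <- enum 'I_m].

Local Notation idx := (nat * seq nat)%type.

Definition mon (x : idx) : V :=
  monomial T (fun i => nth 0%N x.2 i) (gen x.1).2.
Definition valid (x : idx) : bool := (x.1 < size hg)%N && (size x.2 == m).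
Definition ddeg (x : idx) : Z := ((gen x.1).1.2 + Z.of_nat (weight fs x.2))%BZ.
Definition bideg (x : idx) : Z * Z :=
  ((gen x.1).1.1 + Z.of_nat (sumn x.2), ddeg x)%BZ.
(** The generator index is the first letter, so it takes precedence over the exponents. *)
Definition idxlt (x y : idx) : bool := lexlt (x.1 :: x.2) (y.1 :: y.2).
(** These are the monomials that are not leading terms of relations, as in the theory of Groebner
    bases. *)
Definition std (x : idx) : bool :=
  ~~ `[< gspan mon (fun y => [/\ valid y, bideg y = bideg x & idxlt y x]) (mon x) >].

Lemma size_fs : size fs = m. Proof. by rewrite size_map size_enum_ord. Qed.

Lemma nth_fs (i : 'I_m) : nth 0%N fs i = (f i).2.
Proof. by rewrite (nth_map i) ?size_enum_ord // nth_ord_enum. Qed.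

Lemma mon_homog x : valid x -> homog Mg (bideg x, mon x).
Proof.
case: x => j al /andP[/= js /eqP sa]; rewrite /homog /bideg /ddeg /mon /=.
have := monomial_homog HM (fun i => nth 0%N al i) (hgH (mem_nth ((0%BZ, 0%BZ), 0) js)).
congr (Mg (_ + Z.of_nat _) (_ + Z.of_nat _) _).
  under eq_bigr do rewrite Hf1 mul1n.
  by rewrite sumnE (big_nth 0%N) big_mkord sa.
rewrite weightE ?size_fs //.
by apply: eq_bigr => i _; rewrite nth_fs.
Qed.

Definition idx_incr (k : nat) (x : idx) : idx := (x.1, incr_nth x.2 k).

Lemma valid_incr k x : (k < m)%N -> valid x -> valid (idx_incr k x).
Proof. by move=> km /andP[? /eqP sx]; rewrite /valid /= size_incr_nth sx km eqxx andbT. Qed.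

Lemma T_mon (k : 'I_m) x : valid x -> T k (mon x) = mon (idx_incr k x).
Proof.
move=> /andP[_ /eqP sx]; rewrite /mon (T_monomial HM); apply: eq_monomial => i /=.
by rewrite nth_incr_nth eq_sym.
Qed.

Lemma weight_incr (gs al : seq nat) k : size al = size gs -> (k < size gs)%N ->
  weight gs (incr_nth al k) = (nth 0 gs k + weight gs al)%N.
Proof.
elim: gs al k => [|g gs IH] [|a al] [|k] //= [sa]; first by rewrite mulnS addnA.
by rewrite ltnS => ks; rewrite IH // addnCA.
Qed.

Lemma sumn_incr (al : seq nat) k : (k < size al)%N ->
  sumn (incr_nth al k) = (sumn al).+1.
Proof.
elim: al k => [|a al IH] [|k] //=; rewrite ltnS => ks.
by rewrite IH // addnS.
Qed.

Lemma bideg_incr (k : 'I_m) x : valid x ->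
  bideg (idx_incr k x) = ((bideg x).1 + 1, (bideg x).2 + Z.of_nat (f k).2)%BZ.
Proof.
case: x => j al /andP[_ /eqP /= sx]; rewrite /bideg /ddeg /=.
rewrite sumn_incr ?weight_incr ?size_fs ?sx // nth_fs; congr pair; lia.
Qed.

(** Multiplying a relation that expresses a monomial through smaller ones by a variable gives such a
    relation again, so being non-standard passes to multiples. *)
Lemma std_downset j : (j < size hg)%N -> downset m (fun al => std (j, al)).
Proof.
move=> js al k sa km; apply: contra => /asboolP[s sP E].
have vx : valid (j, al) by rewrite /valid js sa eqxx.
apply/asboolP; exists [seq (t.1, idx_incr k t.2) | t <- s] => [_ /mapP[t ts ->] /=|].
  have [vt bt lt] := sP _ ts; split; first exact: valid_incr.
    by rewrite (bideg_incr (Ordinal km)) // bt -(bideg_incr (Ordinal km)).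
  case: t.2 vt lt => i be /andP[_ /eqP /= sb].
  (* The position is [k.+1] because the generator index occupies position 0. *)
  by apply: (@lexlt_incr_nth (i :: be) (j :: al) k.+1) => /=; rewrite ?sa ?sb.
rewrite -[mon _](T_mon (Ordinal km) vx) E (T_sum HM) big_map.
rewrite big_seq [RHS]big_seq; apply: eq_bigr => t ts.
by rewrite (TZ HM) T_mon //; have [] := sP _ ts.
Qed.

Lemma idxlt_trans : transitive idxlt.
Proof. by move=> y x z; exact: lexlt_trans. Qed.

Lemma idxlt_total x y : x != y -> idxlt x y || idxlt y x.
Proof.
move=> xy; apply: lexlt_total; apply: contra xy; case: x y => [j al] [i be] /=.
by rewrite eqseq_cons xpair_eqE.
Qed.

(** The list is decreasing, so the span is built up from the least index. A standard index is
    independent of the tail, since by homogeneity only terms of its own bidegree could produce it; a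
    non-standard one lies in the span of the tail, since [l] contains all smaller indices of its
    bidegree. *)
Lemma has_dim_std (l : seq idx) :
  pairwise (fun x y => idxlt y x) l -> {in l, forall x, valid x} ->
  {in l, forall x y, valid y -> bideg y = bideg x -> idxlt y x -> y \in l} ->
  has_dim (gspan mon (fun x => x \in l)) (count std l).
Proof.
have dec : is_direct_sum_decomp Mg by case: HM => _ [_ []].
elim: l => [|x l IH] /= => [_ _ _|/andP[/allP xl pl] vl cl].
  exact: has_dim_gspan_nil.
have vx := vl x (mem_head _ _).
have {}IH : has_dim (gspan mon (fun x => x \in l)) (count std l).
  apply: IH => // [y yl|y yl z vz bz zy]; first by apply: vl; rewrite inE yl orbT.
  have := cl y _ z vz bz zy; rewrite inE yl orbT => /(_ isT).
  rewrite inE => /predU1P[zx|//]; subst z.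
  by have := idxlt_trans zy (xl y yl); rewrite /idxlt lexlt_irr.
case: (boolP (std x)) => sx; last first.
  rewrite add0n; apply: has_dim_gspan_cons_dep => //.
  move: sx; rewrite negbK => /asboolP; apply: gspan_mono => y [vy by_ yx].
  have := cl x (mem_head _ _) y vy by_ yx; rewrite inE => /predU1P[yE|//].
  by move: yx; rewrite yE /idxlt lexlt_irr.
rewrite add1n; apply: has_dim_gspan_cons_free => //.
apply: contraNnot sx => H; apply/asboolP.
have H' := gspan_component (n := (bideg x).1) (d := (bideg x).2) dec _ (mon_homog vx) H.
apply: gspan_mono (H' bideg _) => [y [yl yE]|y yl].
  split; [by apply: vl; rewrite inE yl orbT | by rewrite yE; case: (bideg x) | exact: xl].
by apply: mon_homog; apply: vl; rewrite inE yl orbT.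
Qed.

(** A row is a finite list because every variable has first degree 1: over generator [j] the
    exponents sum to [n] minus its first degree. *)
Definition allidx (n : Z) : seq idx :=
  flatten [seq if ((gen j).1.1 <=? n)%BZ
               then map (pair j) (compositions m (Z.to_nat (n - (gen j).1.1))) else [::]
          | j <- iota 0 (size hg)].

Lemma mem_allidx n x : (x \in allidx n) = valid x && ((bideg x).1 == n).
Proof.
apply/flatten_mapP/andP => [[j]|[]].
  rewrite mem_iota add0n => /andP[_ js]; case: Z.leb_spec => // jn /mapP[al].
  rewrite mem_compositions => /andP[sa /eqP na] ->.
  by rewrite /valid /= js sa /= na; split=> //; apply/eqP; lia.
case: x => j al /andP[/= js sa] /eqP na; exists j; first by rewrite mem_iota add0n.
rewrite ifT; last by lia.
by apply: map_f; rewrite mem_compositions sa /=; apply/eqP; lia.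
Qed.

Lemma allidx_uniq n : uniq (allidx n).
Proof.
apply: (flatten_map_uniq (key := fst)); first exact: iota_uniq.
  move=> j; case: ifP => // _; rewrite map_inj_uniq ?compositions_uniq //.
  by move=> ? ? [].
by move=> j x; case: ifP => // _ /mapP[al _ ->].
Qed.

(** The negated strict order is total, as the sorting lemmas require, and puts the largest index
    first. *)
Definition sortedidx (n : Z) : seq idx := sort (fun x y => ~~ idxlt x y) (allidx n).

Lemma sortedidx_pairwise n : pairwise (fun x y => idxlt y x) (sortedidx n).
Proof.
have asym x y : idxlt x y -> ~~ idxlt y x.
  by move=> xy; apply/negP => /(idxlt_trans xy); rewrite /idxlt lexlt_irr.
have tot : total (fun x y => ~~ idxlt x y).
  by move=> x y /=; case: (boolP (idxlt x y)) => //= /asym.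
have tr : transitive (fun x y => ~~ idxlt x y).
  move=> y x z xy yz; apply/negP => xz.
  have [E|/idxlt_total] := eqVneq x y; first by rewrite -E xz in yz.
  rewrite (negbTE xy) /= => yx.
  by rewrite (idxlt_trans yx xz) in yz.
have := sort_sorted tot (allidx n); rewrite -/(sortedidx n) sorted_pairwise //.
have : uniq (sortedidx n) by rewrite sort_uniq allidx_uniq.
elim: (sortedidx n) => //= x l IH /andP[xl ul] /andP[/allP al pl].
rewrite IH // andbT; apply/allP => y yl.
have := al y yl; have [E|/idxlt_total] := eqVneq x y; first by rewrite E yl in xl.
by move=> /orP[->|].
Qed.

(** The predicate on the second degree lets one statement cover a whole row and each step of its
    filtration. *)
Lemma has_dim_std_filter (n : Z) (P : pred Z) :
  has_dim (gspan mon (fun x => x \in [seq x <- sortedidx n | P (ddeg x)]))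
    (count P [seq ddeg x | x <- sortedidx n & std x]).
Proof.
have E : count P [seq ddeg x | x <- sortedidx n & std x] =
    count std [seq x <- sortedidx n | P (ddeg x)].
  rewrite count_map !count_filter; apply: eq_count => x /=; exact: andbC.
rewrite E; apply: has_dim_std.
- by apply: pairwise_filter; exact: sortedidx_pairwise.
- by move=> x; rewrite mem_filter mem_sort mem_allidx => /andP[_ /andP[]].
- move=> x; rewrite !mem_filter mem_sort mem_allidx => /andP[Px /andP[_ xn]] y vy bxy _.
  rewrite mem_filter mem_sort mem_allidx vy bxy xn andbT.
  by have /= -> := congr1 snd bxy; rewrite Px.
Qed.

Hypothesis hg_span : forall v, gspan mon valid v.

Definition graded_part (n : Z) (P : pred Z) (v : V) : Prop :=
  exists s : seq (Z * V)%type,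
    List.Forall (fun t => Mg n t.1 t.2 /\ P t.1) s /\ v = \sum_(t <- s) t.2.

Lemma graded_partE n P v : graded_part n P v <->
  gspan mon (fun x => x \in [seq x <- sortedidx n | P (ddeg x)]) v.
Proof.
have dec : is_direct_sum_decomp Mg by case: HM => _ [_ []].
have memE x : (x \in [seq x <- sortedidx n | P (ddeg x)]) =
    [&& P (ddeg x), valid x & (bideg x).1 == n].
  by rewrite mem_filter mem_sort mem_allidx.
split=> [[s [/Forall_inP sH ->]]|[s sP ->]].
  apply: gspan_sum => t /sH[Ht Pt].
  have := gspan_component (g := mon) (deg := bideg) dec mon_homog Ht (hg_span t.2).
  by apply: gspan_mono => x [vx bx]; rewrite memE vx bx eqxx; have /= -> := congr1 snd bx; rewrite Pt.
exists [seq (ddeg t.2, t.1 *: mon t.2) | t <- s]; rewrite big_map; split=> //.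
apply/Forall_inP => _ /mapP[t ts ->] /=.
have := sP _ ts; rewrite memE => /and3P[Pt vt /eqP nt]; split=> //.
by have := mon_homog vt; rewrite /homog /= -nt => /(MgZ dec t.1).
Qed.

Lemma has_dim_graded_part n P :
  has_dim (graded_part n P) (count P [seq ddeg x | x <- sortedidx n & std x]).
Proof.
apply: has_dim_ext (has_dim_std_filter n P) => v.
by split=> /graded_partE.
Qed.

Lemma IZR_ddeg x : IZR (ddeg x) = (weight fs x.2)%:R + IZR (gen x.1).1.2 :> R.
Proof. by rewrite /ddeg plus_IZR -INR_IZR_INZ INRE addrC. Qed.

Lemma evpoly_std_moment k :
  evpoly (fun n => \sum_(d <- [seq ddeg x | x <- sortedidx (Z.of_nat n) & std x])
                     IZR d ^+ k : R).
Proof.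
have E n : \sum_(d <- [seq ddeg x | x <- sortedidx (Z.of_nat n) & std x]) IZR d ^+ k =
    \sum_(j <- iota 0 (size hg)) (if ((gen j).1.1 <=? Z.of_nat n)%BZ then
      (wsum fs (fun al => (j < size hg)%N && std (j, al))
         (('X + (IZR (gen j).1.2)%:P) ^+ k) m (Z.to_nat (Z.of_nat n - (gen j).1.1)))
      else 0) :> R.
  rewrite big_map big_filter (perm_big (allidx (Z.of_nat n))) ?perm_sort //=.
  rewrite big_mkcond big_flatten /= big_map big_seq [RHS]big_seq; apply: eq_bigr => j.
  rewrite mem_iota add0n => /andP[_ ->].
  case: ifP => _; last by rewrite big_nil.
  rewrite big_map -big_mkcond; apply: eq_bigr => al _.
  by rewrite horner_exp hornerD hornerX hornerC IZR_ddeg.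
apply: (evpoly_eventually (N := 0)) => [n _|]; first exact: E.
apply: evpoly_sum => j; apply: (@evpoly_shiftZ _ (wsum fs _ _ m)).
apply: evpoly_wsum; first exact: size_fs.
(* For [j] out of range the guard makes the predicate empty, which is trivially a down-set. *)
by have [js|//] := ltnP j (size hg); exact: std_downset.
Qed.

Lemma ddeg_bound : exists C : Z, forall n x, (1 <= n)%N ->
  x \in sortedidx (Z.of_nat n) -> (Z.abs (ddeg x) <= C * Z.of_nat n)%BZ.
Proof.
pose size_gen (t : (Z * Z) * V) := (Z.to_nat (Z.abs t.1.1) + Z.to_nat (Z.abs t.1.2))%N.
pose A := \max_(t <- hg) size_gen t.
pose B := \max_(g <- fs) g.
(* The exponents in row [n] sum to at most A + n <= (A + 1) n, so the weight is at most B (A + 1) n;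
   the degree of the generator adds at most A <= A n. *)
exists (Z.of_nat (A + B * A.+1)%N) => n x n1.
rewrite mem_sort mem_allidx => /andP[/andP[js _] /eqP nx].
have xA : (Z.to_nat (Z.abs (gen x.1).1.1) + Z.to_nat (Z.abs (gen x.1).1.2) <= A)%N.
  exact: (@leq_bigmax_seq _ hg predT size_gen _ (mem_nth _ js) isT).
have wB : (weight fs x.2 <= B * sumn x.2)%N.
  by apply: weight_leq; apply/allP => g gs; exact: (@leq_bigmax_seq _ fs predT id).
move: nx xA wB; rewrite /bideg /ddeg /=.
move: (gen x.1).1.1 (gen x.1).1.2 (sumn x.2) (weight fs x.2) => a b s w nx xA wB.
clearbody A B.
have sx : (s <= A + n)%N by lia.
have An : (A + n <= A.+1 * n)%N by nia.
have Bs : (B * s <= B * (A.+1 * n))%N by rewrite leq_mul2l (leq_trans sx An) orbT.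
have bA : (Z.abs b <= Z.of_nat A)%BZ by lia.
have wS : (w <= B * A.+1 * n)%N by rewrite -mulnA (leq_trans wB Bs).
by nia.
Qed.

End StandardMonomials.

(** * Degree lists of a finitely generated bigraded module *)

Section DegreeLists.
Variables (K : fieldType) (V : lmodType K) (m : nat).
Variables (f : 'I_m -> nat * nat) (T : 'I_m -> V -> V) (Mg : Z -> Z -> V -> Prop).
Hypothesis Hf1 : forall i, (f i).1 = 1%N.
Hypothesis HM : is_bigraded_module f T Mg.
Hypothesis Hfg : is_finitely_generated T.

Lemma homogeneous_generators : exists2 hg : seq ((Z * Z) * V),
  {in hg, forall t, homog Mg t} & forall v, gspan (mon T hg) (valid m hg) v.
Proof.
have [gens Hgens] := Hfg; have [_ [_ [[_ [dec _]] _]]] := HM.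
have [h Hh] := choice dec.
pose hg := flatten [seq h v | v <- gens].
have hP v : v \in gens -> {subset h v <= hg}.
  by move=> vg t tv; apply/flatten_mapP; exists v.
exists hg => [t /flatten_mapP[v _]|v].
  by have [/Forall_inP + _] := Hh v; apply.
have [s ->] := Hgens v.
apply: gspan_sum => t _; apply: gspanZ.
have [jg|jg] := ltnP t.2 (size gens); last first.
  (* An index beyond [gens] denotes the default vector 0. *)
  by rewrite nth_default // (monomial0 HM); exact: gspan0.
set u := nth 0 gens t.2; have [_ ->] := Hh u.
rewrite (monomial_sum HM); apply: gspan_sum => t' t'u.
have t'h : t' \in hg by apply: hP t'u; exact: mem_nth.
pose al := [seq t.1.2 i | i <- enum 'I_m].
have -> : monomial T t.1.2 t'.2 = mon T hg (index t' hg, al).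
  rewrite /mon /= nth_index //; apply: eq_monomial => i.
  by rewrite (nth_map i) ?size_enum_ord // nth_ord_enum.
by apply: gspan_mem; rewrite /valid /= index_mem t'h size_map size_enum_ord /=.
Qed.

(** The interface between algebra and analysis: from here on the structure of the module enters only
    through these lists. *)
Lemma degree_lists : exists degs : nat -> seq Z,
  [/\ forall n, has_dim (row_space Mg (Z.of_nat n)) (size (degs n)),
      forall n r, has_dim (filt_space Mg (Z.of_nat n) r)
                          (count (fun d => `[< Rle r (IZR d) >]) (degs n)),
      exists C : Z, forall n d, (1 <= n)%N -> d \in degs n ->
         (Z.abs d <= C * Z.of_nat n)%BZ &
      forall k, evpoly (fun n => \sum_(d <- degs n) IZR d ^+ k : R)].
Proof.
have [hg hgH hgS] := homogeneous_generators.
exists (fun n => [seq ddeg f hg x | x <- sortedidx m hg (Z.of_nat n) & std f T hg x]).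
split.
- move=> n; rewrite -(count_predT [seq _ | _ <- _]).
  apply: has_dim_ext (has_dim_graded_part Hf1 HM hgH hgS (Z.of_nat n) predT) => v.
  split=> -[s [/Forall_inP sH ->]]; exists s; split=> //; apply/Forall_inP => t /sH //.
  by case.
- move=> n r.
  apply: has_dim_ext (has_dim_graded_part Hf1 HM hgH hgS (Z.of_nat n)
           (fun d => `[< Rle r (IZR d) >])) => v.
  split=> -[s [/Forall_inP sH ->]]; exists s; split=> //; apply/Forall_inP => t /sH[].
    by move=> ? /asboolP.
  by move=> ? ?; split=> //; apply/asboolP.
- have [C HC] := ddeg_bound f hg; exists C => n d n1 /mapP[x].
  by rewrite mem_filter => /andP[_ /(HC _ _ n1)] H ->.
- by move=> k; exact: (evpoly_std_moment HM).
Qed.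

End DegreeLists.

(** * Asymptotics of quotients of polynomials *)

Section RatioLimits.
Import Coquelicot.Coquelicot.
Local Open Scope R_scope.

Definition lsum (phi : R -> R) (s : seq R) : R :=
  foldr (fun x acc => phi x + acc) 0 s.

Definition mean (s : seq R) (phi : R -> R) : R := lsum phi s / INR (size s).

(** Induction through p = q X + c. The coefficient at [D] may vanish; the limit is then 0, which is
    what excludes a numerator of larger degree in [bounded_ratio_cv]. *)
Lemma horner_asymptotic D (p : {poly R}) : (size p <= D.+1)%N ->
  is_lim_seq (fun n => p.[INR n] / INR n ^ D) (p`_D)%R.
Proof.
elim: D p => [|D IH] p sp.
  apply: (is_lim_seq_ext (fun=> (p`_0)%R)); last exact: is_lim_seq_const.
  by move=> n; rewrite (size1_polyC sp) hornerC coefC eqxx /=; field.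
elim/poly_ind: p sp => [_|q c _ sp].
  apply: (is_lim_seq_ext (fun=> 0)); last by rewrite coef0; exact: is_lim_seq_const.
  by move=> n; rewrite horner0 /Rdiv Rmult_0_l.
have sq : (size q <= D.+1)%N.
  by move: sp; rewrite size_MXaddC; case: ifP => // /andP[/eqP -> _]; rewrite size_poly0.
rewrite coefD coefMX coefC /= addr0.
apply: (is_lim_seq_ext_loc (fun n => q.[INR n] / INR n ^ D + c * (/ INR n ^ D.+1))).
  exists 1%N => n n1; rewrite hornerMXaddC.
  have n0 : INR n <> 0 by apply: not_0_INR; lia.
  have nD : INR n ^ D <> 0 by exact: pow_nonzero.
  rewrite -RplusE -RmultE /=; field; split=> //.
suff H : is_lim_seq (fun n => c * / INR n ^ D.+1) 0.
  by have := is_lim_seq_plus' _ _ _ _ (IH _ sq) H; rewrite Rplus_0_r.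
suff H : is_lim_seq (fun n => / INR n ^ D.+1) 0.
  by have := is_lim_seq_scal_l _ c _ H; rewrite /= Rmult_0_r.
apply: (is_lim_seq_inv _ p_infty) => //.
elim: D {IH sp sq} => [|D IH] /=.
  apply: (is_lim_seq_ext INR); last exact: is_lim_seq_INR.
  by move=> n; rewrite Rmult_1_r.
apply: (is_lim_seq_mult _ _ p_infty p_infty) => //; exact: is_lim_seq_INR.
Qed.

Lemma bounded_ratio_cv (p q : {poly R}) (B : R) N : q != 0%R ->
  (forall n, (N <= n)%N -> Rabs p.[INR n] <= B * Rabs q.[INR n]) ->
  exists l : R, is_lim_seq (fun n => p.[INR n] / q.[INR n]) l.
Proof.
move=> q0 pq.
have npos D : exists M, forall n, le M n -> 0 < INR n ^ D.
  by exists 1%N => n n1; apply: pow_lt; apply: lt_0_INR; lia.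
have sq : (0 < size q)%N by rewrite size_poly_gt0.
have [spq|spq] := leqP (size p) (size q).
  have lq : (q`_(size q).-1)%R <> 0 by apply/eqP; rewrite -/(lead_coef q) lead_coef_eq0.
  have Hp := @horner_asymptotic (size q).-1 p.
  have Hq := @horner_asymptotic (size q).-1 q.
  rewrite prednK // in Hp Hq.
  exists (p`_(size q).-1 / q`_(size q).-1)%R.
  apply: (is_lim_seq_ext_loc _ _ _ _ (is_lim_seq_div' _ _ _ _ (Hp spq) (Hq (leqnn _)) lq)).
  have [M HM] := npos (size q).-1; exists M => n /HM n0.
  (* Where [q] vanishes both sides are 0, since division by 0 gives 0. *)
  have [qn0|qn0] := Req_EM_T q.[INR n] 0.
    by rewrite qn0 /Rdiv Rmult_0_l Rinv_0 !Rmult_0_r.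
  field; split=> //; exact: Rgt_not_eq.
(* If [p] had the larger degree, dividing the bound by n^(deg p) and passing to the limit would make
   its leading coefficient 0. *)
exfalso.
have sp : (0 < size p)%N by apply: leq_trans spq.
have Hp := @horner_asymptotic (size p).-1 p.
have Hq := @horner_asymptotic (size p).-1 q.
rewrite prednK // in Hp Hq; have {}Hp := Hp (leqnn _); have {}Hq := Hq (ltnW spq).
rewrite nth_default in Hq; last by rewrite -ltnS prednK.
have lp : (p`_(size p).-1)%R <> 0.
  by apply/eqP; rewrite -/(lead_coef p) lead_coef_eq0 -size_poly_gt0.
apply: lp; apply: Rabs_eq_0.
have := is_lim_seq_scal_l _ B _ (is_lim_seq_abs _ _ Hq); rewrite /= Rabs_R0 Rmult_0_r => HB.
have : Rbar_le (Rabs (p`_(size p).-1)%R) 0.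
  apply: is_lim_seq_le_loc (is_lim_seq_abs _ _ Hp) HB.
  have [M HM] := npos (size p).-1; exists (M + N)%coq_nat => n Hn.
  have n0 : 0 < INR n ^ (size p).-1 by apply: HM; lia.
  rewrite /Rdiv !Rabs_mult -Rmult_assoc.
  by apply: Rmult_le_compat_r; [exact: Rabs_pos | apply: pq; lia].
by move=> /= H; apply: Rle_antisym => //; exact: Rabs_pos.
Qed.

End RatioLimits.

(** * Moments of the rescaled degrees *)

Section Moments.
Import Coquelicot.Coquelicot.
Local Open Scope R_scope.
Variables (degs : nat -> seq Z) (C : Z).
Hypothesis degs_bound : forall n d, (1 <= n)%N -> d \in degs n ->
  (Z.abs d <= C * Z.of_nat n)%BZ.
Hypothesis degs_moments : forall k, evpoly (fun n => \sum_(d <- degs n) IZR d ^+ k : R)%R.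

Definition rescaled (n : nat) : seq R := [seq IZR d / INR n | d <- degs n].

Lemma rescaled_bound n x : (1 <= n)%N -> x \in rescaled n -> Rabs x <= IZR C.
Proof.
move=> n1 /mapP[d dn ->].
have n0 : 0 < INR n by apply: lt_0_INR; lia.
rewrite Rabs_mult (Rabs_pos_eq (/ _)); last by apply/Rlt_le/Rinv_0_lt_compat.
apply: (Rmult_le_reg_r (INR n)) => //.
rewrite Rmult_assoc Rinv_l ?Rmult_1_r; last exact: Rgt_not_eq.
rewrite -abs_IZR INR_IZR_INZ -mult_IZR; apply: IZR_le.
exact: degs_bound.
Qed.

Lemma size_degs_moment n : INR (size (degs n)) = (\sum_(d <- degs n) IZR d ^+ 0)%R.
Proof.
elim: (degs n) => [|d s IH]; first by rewrite big_nil.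
by rewrite big_cons -IH expr0 -RplusE [size _]/= S_INR Rplus_comm.
Qed.

Lemma lsum_rescaled n k : (1 <= n)%N ->
  lsum (fun x => x ^ k) (rescaled n) = (\sum_(d <- degs n) IZR d ^+ k)%R / INR n ^ k.
Proof.
move=> n1; have n0 : INR n <> 0 by apply: not_0_INR; lia.
rewrite /rescaled; elim: (degs n) => [|d s IH]; first by rewrite big_nil /= /Rdiv Rmult_0_l.
rewrite big_cons /= IH -RplusE -RpowE Rpow_mult_distr pow_inv.
by rewrite /Rdiv Rmult_plus_distr_r.
Qed.

(** With [q] the dimension polynomial and [p] the polynomial of the k-th power sum, the k-th moment
    is p(n) / (n^k q(n)), bounded by C^k because the rescaled degrees are bounded by C. The
    alternative is whether [q] is zero. *)
Lemma rescaled_dichotomy :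
  (exists N, forall n, (N <= n)%N -> degs n = [::]) \/
  (exists N, forall n, (N <= n)%N -> degs n <> [::]) /\
  (forall k, exists l : R, Un_cv (fun n => mean (rescaled n) (fun x => x ^ k)) l).
Proof.
have [q [Nq Hq]] := degs_moments 0.
have sizeE n : (Nq <= n)%N -> INR (size (degs n)) = q.[INR n].
  by move=> nN; rewrite size_degs_moment INRE Hq.
have [q0|q0] := eqVneq q 0%R.
  left; exists Nq => n /sizeE; rewrite q0 horner0 => H.
  by apply: size0nil; apply: INR_eq; rewrite H.
right.
have key k : exists l : R, is_lim_seq (fun n => mean (rescaled n) (fun x => x ^ k)) l.
  have [p [Np Hp]] := degs_moments k.
  have meanE n : (1 + Nq + Np <= n)%N ->
      mean (rescaled n) (fun x => x ^ k) = p.[INR n] / (INR n ^ k * q.[INR n]).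
    move=> Hn; rewrite /mean lsum_rescaled; last by lia.
    rewrite Hp; last by lia.
    rewrite /rescaled size_map sizeE; last by lia.
    have n0 : INR n ^ k <> 0 by apply/pow_nonzero/not_0_INR; lia.
    rewrite -INRE.
    have [q1|q1] := Req_EM_T q.[INR n] 0; last by field.
    by rewrite q1 Rmult_0_r /Rdiv Rinv_0 !Rmult_0_r.
  have HX n : ('X^k * q)%R.[INR n] = INR n ^ k * q.[INR n].
    by rewrite hornerM hornerXn RpowE.
  have [||l Hl] := @bounded_ratio_cv p ('X^k * q)%R (IZR C ^ k) (1 + Nq + Np).
  - by rewrite mulf_neq0 // expf_neq0 // polyX_eq0.
  - move=> n Hn.
    have n0 : 0 < INR n ^ k by apply/pow_lt/lt_0_INR; lia.
    have -> : p.[INR n] = lsum (fun x => x ^ k) (rescaled n) * INR n ^ k.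
      rewrite lsum_rescaled; last by lia.
      rewrite Hp -?INRE; last by lia.
      by rewrite /Rdiv Rmult_assoc Rinv_l ?Rmult_1_r //; lra.
    rewrite HX -sizeE; last by lia.
    rewrite !Rabs_mult (Rabs_pos_eq (INR (size _))); last exact: pos_INR.
    rewrite (Rmult_comm (Rabs (INR n ^ k))) -Rmult_assoc.
    apply: Rmult_le_compat_r; first exact: Rabs_pos.
    have -> : size (degs n) = size (rescaled n) by rewrite size_map.
    have : forall x, x \in rescaled n -> Rabs x <= IZR C.
      by move=> x; apply: rescaled_bound; lia.
    elim: (rescaled n) => [_|x s IH H]; first by rewrite /= Rabs_R0 Rmult_0_r; lra.
    rewrite [lsum _ _]/= -/(lsum _ _) [size _]/= S_INR Rmult_plus_distr_l Rmult_1_r.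
    apply: Rle_trans (Rabs_triang _ _) _; rewrite Rplus_comm; apply: Rplus_le_compat.
      by apply: IH => y ys; apply: H; rewrite inE ys orbT.
    rewrite -RPow_abs; apply: pow_incr; split; first exact: Rabs_pos.
    by apply: H; rewrite inE eqxx.
  exists l; apply: is_lim_seq_ext_loc Hl.
  by exists (1 + Nq + Np)%N => n Hn; rewrite HX meanE //; lia.
split; last by move=> k; have [l Hl] := key k; exists l; apply/is_lim_seq_Reals.
(* A nonzero [q] has no large natural roots, because q(n) / n^(deg q) tends to its leading
   coefficient. *)
have sq : (0 < size q)%N by rewrite size_poly_gt0.
have Hasym := @horner_asymptotic (size q).-1 q.
rewrite prednK // in Hasym; have {}Hasym := Hasym (leqnn _).
have lq : (q`_(size q).-1)%R <> 0 by apply/eqP; rewrite -/(lead_coef q) lead_coef_eq0.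
have := is_lim_seq_abs _ _ Hasym => /is_lim_seq_Reals.
move=> /(_ (Rabs (q`_(size q).-1)%R)) []; first exact: Rabs_pos_lt.
move=> M HM; exists (M + Nq)%N => n Hn dn.
have := HM n; rewrite -sizeE; last by lia.
rewrite dn /= /Rdiv Rmult_0_l Rabs_R0 /Rdist Rminus_0_l Rabs_Ropp Rabs_Rabsolu => H.
by apply: (Rlt_irrefl (Rabs (q`_(size q).-1)%R)); apply: H; lia.
Qed.

End Moments.

(** * Averages over finite lists *)

Section Means.
Import Coquelicot.Coquelicot.
Local Open Scope R_scope.

Lemma eq_in_lsum (s : seq R) (phi psi : R -> R) :
  {in s, forall x, phi x = psi x} -> lsum phi s = lsum psi s.
Proof.
elim: s => //= x s IH H; rewrite H ?mem_head // IH // => y ys.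
by apply: H; rewrite inE ys orbT.
Qed.

Lemma lsum_le (s : seq R) (phi psi : R -> R) :
  {in s, forall x, phi x <= psi x} -> lsum phi s <= lsum psi s.
Proof.
elim: s => [_|x s IH H] /=; first exact: Rle_refl.
apply: Rplus_le_compat; first by apply: H; rewrite mem_head.
by apply: IH => y ys; apply: H; rewrite inE ys orbT.
Qed.

Lemma lsum_lin (s : seq R) (a : R) (phi psi : R -> R) :
  lsum (fun x => a * phi x + psi x) s = a * lsum phi s + lsum psi s.
Proof. elim: s => [|x s IH] /=; [ring | by rewrite IH; ring]. Qed.

Lemma lsum_const (s : seq R) c : lsum (fun=> c) s = c * INR (size s).
Proof. elim: s => [|x s IH] /=; first ring. by rewrite IH -/(INR (size s).+1) S_INR; ring. Qed.

Lemma size_INR_pos (s : seq R) : s <> [::] -> 0 < INR (size s).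
Proof. by case: s => // x s _; apply: lt_0_INR => /=; lia. Qed.

Lemma inv_size_ge0 (s : seq R) : 0 <= / INR (size s).
Proof.
case: s => [|x s]; first by rewrite /= Rinv_0; exact: Rle_refl.
by apply/Rlt_le/Rinv_0_lt_compat/size_INR_pos.
Qed.

Lemma eq_in_mean (s : seq R) (phi psi : R -> R) :
  {in s, forall x, phi x = psi x} -> mean s phi = mean s psi.
Proof. by move=> H; rewrite /mean (eq_in_lsum H). Qed.

Lemma mean_le (s : seq R) (phi psi : R -> R) :
  {in s, forall x, phi x <= psi x} -> mean s phi <= mean s psi.
Proof. by move=> /lsum_le H; apply: Rmult_le_compat_r => //; exact: inv_size_ge0. Qed.

Lemma mean_lin (s : seq R) (a : R) (phi psi : R -> R) :
  mean s (fun x => a * phi x + psi x) = a * mean s phi + mean s psi.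
Proof. rewrite /mean lsum_lin /Rdiv; ring. Qed.

Lemma mean_const (s : seq R) c : s <> [::] -> mean s (fun=> c) = c.
Proof. by move=> /size_INR_pos s0; rewrite /mean lsum_const; field; lra. Qed.

Lemma mean_close (s : seq R) (phi psi : R -> R) eps : s <> [::] ->
  {in s, forall x, Rabs (phi x - psi x) <= eps} ->
  Rabs (mean s phi - mean s psi) <= eps.
Proof.
move=> s0 H.
have E : mean s (fun x => 1 * psi x + eps) = mean s psi + eps.
  by rewrite mean_lin mean_const //; ring.
have E' : mean s (fun x => 1 * phi x + eps) = mean s phi + eps.
  by rewrite mean_lin mean_const //; ring.
have le1 : mean s phi <= mean s psi + eps.
  by rewrite -E; apply: mean_le => x /H /Rabs_le_between; lra.
have le2 : mean s psi <= mean s phi + eps.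
  by rewrite -E'; apply: mean_le => x /H /Rabs_le_between; lra.
apply: Rabs_le; lra.
Qed.

End Means.

(** * Weierstrass approximation by Bernstein polynomials *)

Section Bernstein.
Import Coquelicot.Coquelicot.
Local Open Scope R_scope.

(* [bernstein N psi 0 x] is the expectation of [psi] at a binomial(N, x) variable;
   conditioning on the first trial avoids binomial coefficients. *)
Fixpoint bernstein (N : nat) (psi : nat -> R) (j : nat) (x : R) : R :=
  if N is N'.+1 then x * bernstein N' psi j.+1 x + (1 - x) * bernstein N' psi j x
  else psi j.

Lemma bernstein_le N psi psi' j x : 0 <= x <= 1 ->
  (forall k, (k <= j + N)%N -> psi k <= psi' k) ->
  bernstein N psi j x <= bernstein N psi' j x.
Proof.
move=> x01; elim: N j => [|N IH] j H /=; first by apply: H; lia.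
apply: Rplus_le_compat; apply: Rmult_le_compat_l; try lra; apply: IH => k Hk; apply: H; lia.
Qed.

Lemma bernstein_lin N a b psi j x :
  bernstein N (fun k => a * psi k + b) j x = a * bernstein N psi j x + b.
Proof. by elim: N j => [|N IH] j //=; rewrite !IH; ring. Qed.

(** Squared bias plus variance, for the sum of [j] and a binomial(N, x) variable. *)
Lemma bernstein_variance N a j x :
  bernstein N (fun k => (INR k - a) ^ 2) j x =
  (INR j + INR N * x - a) ^ 2 + INR N * (x * (1 - x)).
Proof.
elim: N j => [|N IH] j; first by rewrite /=; ring.
by rewrite [LHS]/= !IH !S_INR; ring.
Qed.

(** Bernstein's proof. If M bounds |phi| on [-C, C] and d is a modulus of uniform continuity for
    eps/2, then |phi z - phi y| <= eps/2 + (2 M / d^2) (z - y)^2 there. In expectation over the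
    binomial node z, whose mean is y, the square becomes a variance of order 1/N. *)
Lemma weierstrass (C : R) (phi : R -> R) (eps : R) : 0 < C -> continuity phi -> 0 < eps ->
  exists N (psi : nat -> R), forall y, Rabs y <= C ->
    Rabs (phi y - bernstein N psi 0 ((y + C) / (2 * C))) <= eps.
Proof.
move=> C0 cphi e0.
have e2 : 0 < eps / 2 by lra.
have [[d d0] /= Hd] := @Heine_cor2 phi (- C) C (fun x _ => cphi x) (mkposreal _ e2).
have [xM [HM _]] : exists xM, (forall c, - C <= c <= C -> Rabs (phi c) <= Rabs (phi xM)) /\ - C <= xM <= C.
  apply: (continuity_ab_maj (fun x => Rabs (phi x))) => [|c _]; first lra.
  by apply: (continuity_pt_comp phi Rabs) => //; exact: Rcontinuity_abs.
set M := Rabs (phi xM) in HM.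
have M0 : 0 <= M by exact: Rabs_pos.
(* The nodes are spaced by 2 C / N and x (1 - x) <= 1, so the variance term will be at most A /
   N. *)
pose A := 2 * M / (d * d) * (4 * (C * C)).
have A0 : 0 <= A.
  apply: Rmult_le_pos; last nra.
  by apply: Rmult_le_pos; [lra | apply/Rlt_le/Rinv_0_lt_compat; nra].
have [N HN] := INR_unbounded (A / (eps / 2)).
have AN : A <= eps / 2 * INR N.
  have := Rmult_lt_compat_l (eps / 2) _ _ e2 HN.
  have -> : eps / 2 * (A / (eps / 2)) = A by field; lra.
  lra.
have N0 : 0 < INR N.
  apply: Rle_lt_trans HN; apply: Rmult_le_pos => //.
  by apply/Rlt_le/Rinv_0_lt_compat.
exists N, (fun k => phi (- C + 2 * C * (INR k / INR N))) => y /Rabs_le_between yC.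
set x := (y + C) / (2 * C).
have x01 : 0 <= x <= 1.
  split.
    by apply: Rmult_le_pos; [lra | apply/Rlt_le/Rinv_0_lt_compat; lra].
  by apply: (Rmult_le_reg_r (2 * C)); [lra | rewrite /x; field_simplify; lra].
have yE : y = - C + 2 * C * x by rewrite /x; field; lra.
pose B := 2 * M / (d * d) * ((2 * C / INR N) * (2 * C / INR N)).
have B0 : 0 <= B.
  apply: Rmult_le_pos; last by nra.
  by apply: Rmult_le_pos; [lra | apply/Rlt_le/Rinv_0_lt_compat; nra].
have pt k : (k <= 0 + N)%N ->
    Rabs (phi (- C + 2 * C * (INR k / INR N)) - phi y) <= eps / 2 + B * (INR k - INR N * x) ^ 2.
  move=> kN; set z := _ + _.
  have kN' : 0 <= INR k / INR N <= 1.
    split; first by apply: Rmult_le_pos; [exact: pos_INR | apply/Rlt_le/Rinv_0_lt_compat].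
    apply: (Rmult_le_reg_r (INR N)) => //.
    have -> : INR k / INR N * INR N = INR k by field; lra.
    by rewrite Rmult_1_l; apply: le_INR; lia.
  have zC : - C <= z <= C by move: kN' C0; rewrite /z; clear; nra.
  have zy : z - y = 2 * C / INR N * (INR k - INR N * x).
    by rewrite /z yE; field; lra.
  have BE : B * (INR k - INR N * x) ^ 2 = 2 * M / (d * d) * ((z - y) * (z - y)).
    by rewrite zy /B; ring.
  have sq0 : 0 <= B * (INR k - INR N * x) ^ 2.
    by apply: Rmult_le_pos => //; apply: pow2_ge_0.
  have [close|far] := Rlt_le_dec (Rabs (z - y)) d.
    by have := Hd z y zC yC close; lra.
  have : d * d <= (z - y) * (z - y).
    rewrite -(Rabs_pos_eq ((z - y) * (z - y))); last exact: Rle_0_sqr.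
    rewrite Rabs_mult; apply: Rmult_le_compat; lra.
  move=> H; have : 2 * M <= B * (INR k - INR N * x) ^ 2.
    rewrite BE; apply: (Rle_trans _ (2 * M / (d * d) * (d * d))); first by right; field; lra.
    apply: Rmult_le_compat_l => //.
    by apply: Rmult_le_pos; [lra | apply/Rlt_le/Rinv_0_lt_compat; nra].
  have := Rabs_triang (phi z) (- phi y); rewrite Rabs_Ropp.
  have := HM z zC; have := HM y yC; rewrite /Rminus; lra.
have var : B * (INR N * (x * (1 - x))) <= eps / 2.
  have -> : B * (INR N * (x * (1 - x))) = A * (x * (1 - x)) / INR N.
    by rewrite /A /B; field; lra.
  apply: (Rmult_le_reg_r (INR N)) => //.
  have -> : A * (x * (1 - x)) / INR N * INR N = A * (x * (1 - x)) by field; lra.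
  apply: Rle_trans AN; rewrite -[X in _ <= X]Rmult_1_r.
  by apply: Rmult_le_compat_l => //; move: x01; clear; nra.
have V := bernstein_variance N (INR N * x) 0 x.
rewrite [INR 0]/= Rplus_0_l Rminus_diag in V.
have U1 : bernstein N (fun k => phi (- C + 2 * C * (INR k / INR N))) 0 x <=
    B * bernstein N (fun k => (INR k - INR N * x) ^ 2) 0 x + (phi y + eps / 2).
  rewrite -bernstein_lin; apply: bernstein_le => // k /pt /Rabs_le_between; lra.
have U2 : (- B) * bernstein N (fun k => (INR k - INR N * x) ^ 2) 0 x + (phi y - eps / 2) <=
    bernstein N (fun k => phi (- C + 2 * C * (INR k / INR N))) 0 x.
  rewrite -bernstein_lin; apply: bernstein_le => // k /pt /Rabs_le_between; lra.
rewrite V (_ : 0 ^ 2 + _ = INR N * (x * (1 - x))) in U1 U2; last by ring.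
by move: U1 U2; rewrite Ropp_mult_distr_l_reverse => U1 U2; apply: Rabs_le; lra.
Qed.

End Bernstein.

(** * Convergence of the means of continuous functions *)

Section ConvergenceOfMeans.
Import Coquelicot.Coquelicot.
Local Open Scope R_scope.
Variables (s : nat -> seq R) (C : R) (N0 : nat).
Hypothesis C0 : 0 < C.
Hypothesis s_neq0 : forall n, (N0 <= n)%N -> s n <> [::].
Hypothesis s_bound : forall n, (N0 <= n)%N -> {in s n, forall x, Rabs x <= C}.
Hypothesis s_moments : forall k, exists l, Un_cv (fun n => mean (s n) (fun x => x ^ k)) l.

Definition cvmean (phi : R -> R) : Prop := exists l, Un_cv (fun n => mean (s n) phi) l.

Lemma cvmean_lin a phi psi : cvmean phi -> cvmean psi -> cvmean (fun x => a * phi x + psi x).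
Proof.
move=> [l /is_lim_seq_Reals Hl] [l' /is_lim_seq_Reals Hl']; exists (a * l + l').
apply/is_lim_seq_Reals.
apply: (is_lim_seq_ext (fun n => a * mean (s n) phi + mean (s n) psi)).
  by move=> n; rewrite mean_lin.
by apply: is_lim_seq_plus' => //; exact: (is_lim_seq_scal_l _ a _ Hl).
Qed.

Lemma cvmean_ext phi psi : (forall x, phi x = psi x) -> cvmean phi -> cvmean psi.
Proof. by move=> E; have -> : phi = psi by apply: funext. Qed.

(** The factor y^k makes the induction possible: each step multiplies by affine functions of y,
    which mixes the exponents k and k + 1. *)
Lemma cvmean_bernstein N psi j k :
  cvmean (fun y => y ^ k * bernstein N psi j ((y + C) / (2 * C))).
Proof.
elim: N j k => [|N IH] j k.
  (* The monomial with coefficient [psi j] is split so as to have the shape that [cvmean_lin]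
     handles. *)
  apply: (@cvmean_ext (fun y => (psi j - 1) * y ^ k + y ^ k)) => [y /=|]; first ring.
  by apply: cvmean_lin; exact: s_moments.
apply: (@cvmean_ext (fun y =>
    (/ (2 * C)) * (y ^ k.+1 * bernstein N psi j.+1 ((y + C) / (2 * C))) +
   (/ 2 * (y ^ k * bernstein N psi j.+1 ((y + C) / (2 * C))) +
   ((- / (2 * C)) * (y ^ k.+1 * bernstein N psi j ((y + C) / (2 * C))) +
   ((/ 2 - 1) * (y ^ k * bernstein N psi j ((y + C) / (2 * C))) +
    y ^ k * bernstein N psi j ((y + C) / (2 * C))))))) => [y /=|]; first by field; lra.
by do 4 (apply: cvmean_lin => //).
Qed.

(** Averaging does not increase a uniform distance on the points, so approximation by polynomials,
    whose means converge, makes the means of [phi] a Cauchy sequence. *)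
Theorem cvmean_continuous phi : continuity phi -> cvmean phi.
Proof.
move=> cphi.
suff H : Cauchy_crit (fun n => mean (s n) phi).
  by have [l Hl] := Rcomplete.R_complete _ H; exists l.
move=> eps e0; have e3 : 0 < eps / 3 by lra.
have [N [psi Hpsi]] := weierstrass C0 cphi e3.
have [l Hl] := cvmean_bernstein N psi 0 0.
have [M HM] := CV_Cauchy _ (exist _ l Hl) _ e3; exists (M + N0)%N => n k Hn Hk.
have close i : (N0 <= i)%N -> Rabs (mean (s i) phi -
    mean (s i) (fun y => y ^ 0 * bernstein N psi 0 ((y + C) / (2 * C)))) <= eps / 3.
  move=> Hi; apply: mean_close; first exact: s_neq0.
  by move=> x xs /=; rewrite Rmult_1_l; apply: Hpsi; apply: s_bound Hi _ xs.
have nk : (M <= n)%coq_nat /\ (M <= k)%coq_nat /\ (N0 <= n)%N /\ (N0 <= k)%N by lia.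
case: nk => [nM [kM [nN kN]]].
have /Rabs_lt_between H1 := HM n k nM kM.
have /Rabs_le_between H2 := close n nN.
have /Rabs_le_between H3 := close k kN.
by apply/Rabs_lt_between; lra.
Qed.

End ConvergenceOfMeans.

(** * Borel sets *)

Section BorelSets.
Import Coquelicot.Coquelicot.
Local Open Scope R_scope.

Lemma pred_ext (A B : R -> Prop) : (forall x, A x <-> B x) -> A = B.
Proof. by move=> AB; apply: funext => x; apply: propext. Qed.

Lemma is_borel_ext (A B : R -> Prop) : (forall x, A x <-> B x) -> is_borel A -> is_borel B.
Proof. by move=> /pred_ext ->. Qed.

Lemma is_borel_empty : is_borel (fun=> False).
Proof. by apply: borel_open. Qed.

Lemma is_borel_or (A B : R -> Prop) :
  is_borel A -> is_borel B -> is_borel (fun x => A x \/ B x).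
Proof.
move=> bA bB.
apply: is_borel_ext (borel_union (A := fun k => if k is 0%N then A else B) _) => [x|[|k]] //.
by split=> [[[|k] H]|[H|H]]; [left|right|exists 0%N|exists 1%N].
Qed.

Lemma is_borel_and (A B : R -> Prop) :
  is_borel A -> is_borel B -> is_borel (fun x => A x /\ B x).
Proof.
move=> bA bB; apply: is_borel_ext (borel_compl (is_borel_or (borel_compl bA) (borel_compl bB))).
by move=> x; split=> [/not_orP[/contrapT ? /contrapT ?]|[? ?] []].
Qed.

Lemma open_ray_gt a : open_set (fun x => a < x).
Proof.
move=> x ax; have d0 : 0 < x - a by lra.
by exists (mkposreal _ d0) => y; rewrite /disc /= => /Rabs_lt_between; lra.
Qed.

Lemma is_borel_gt a : is_borel (fun x => a < x).
Proof. by apply: borel_open; exact: open_ray_gt. Qed.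

Lemma is_borel_ge a : is_borel (fun x => a <= x).
Proof.
apply: (is_borel_ext (A := fun x => ~ x < a)) => [x|]; first by split; lra.
apply: borel_compl; apply: borel_open => x xa; have d0 : 0 < a - x by lra.
by exists (mkposreal _ d0) => y; rewrite /disc /= => /Rabs_lt_between; lra.
Qed.

Lemma is_borel_eq a : is_borel (fun x => x = a).
Proof.
apply: is_borel_ext (is_borel_and (is_borel_ge a) (borel_compl (is_borel_gt a))) => x.
by split; lra.
Qed.

Lemma is_borel_mem (s : seq R) : is_borel (fun x => x \in s).
Proof.
elim: s => [|a s IH]; first by apply: is_borel_ext is_borel_empty.
apply: is_borel_ext (is_borel_or (is_borel_eq a) IH) => x.
by rewrite inE; split=> [[->|->]|/predU1P //]; rewrite ?eqxx ?orbT.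
Qed.

Lemma is_borel_scale c A : 0 < c -> is_borel A -> is_borel (fun x => A (c * x)).
Proof.
move=> c0; elim=> {A} [A oA|A _ IH|A _ IH].
- apply: borel_open => x /oA[[d d0] Hd].
  have d0' : 0 < d / c by apply: Rdiv_lt_0_compat.
  exists (mkposreal _ d0') => y; rewrite /disc /= => H; apply: Hd; rewrite /disc /=.
  rewrite -Rmult_minus_distr_l Rabs_mult Rabs_pos_eq; last lra.
  by apply: (Rmult_lt_reg_l (/ c)); [exact: Rinv_0_lt_compat | field_simplify; lra].
- exact: borel_compl.
- exact: borel_union.
Qed.

Lemma is_borel_superlevel phi c : continuity phi -> is_borel (fun x => c <= phi x).
Proof.
move=> cphi; apply: (is_borel_ext (A := fun x => ~ phi x < c)) => [x|]; first by split; lra.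
apply: borel_compl; apply: borel_open => x xc; have d0 : 0 < c - phi x by lra.
have [d [dp Hd]] := cphi x _ d0.
exists (mkposreal _ dp) => y; rewrite /disc /= => yx.
have [->//|xy] := Req_EM_T y x.
have := Hd y; rewrite /Rdist => /(_ _)/Rabs_lt_between H.
by have : - (c - phi x) < phi y - phi x < c - phi x;
  [apply: H; split=> //; split=> //; exact/nesym | lra].
Qed.

End BorelSets.

(** * Additivity and continuity from below *)

Section MeasureFacts.
Import Coquelicot.Coquelicot.
Local Open Scope R_scope.
Variable mu : (R -> Prop) -> R.
Hypothesis muB : borel_measure mu.

Lemma mu_or (A B : R -> Prop) : is_borel A -> is_borel B ->
  (forall x, A x -> B x -> False) -> mu (fun x => A x \/ B x) = mu A + mu B.
Proof.
move=> bA bB AB; have [_ [mu0 muS]] := muB.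
pose F k := match k with 0%N => A | 1%N => B | _ => fun=> False end.
have bF k : is_borel (F k) by case: k => [|[|k]] //; exact: is_borel_empty.
have dF i j x : i <> j -> F i x -> F j x -> False.
  by case: i => [|[|i]]; case: j => [|[|j]] //= _ H1 H2; apply: (AB x).
have := muS F bF dF.
have -> : (fun x => exists k, F k x) = (fun x => A x \/ B x).
  apply: pred_ext => x; split=> [[[|[|k]] //]|[]]; [by left|by right|by exists 0%N|by exists 1%N].
move=> H; apply: (UL_sequence (fun n => sum_f_R0 (fun k => mu (F k)) n)); first exact: H.
move=> eps e0; exists 1%N => n n1.
have -> : sum_f_R0 (fun k => mu (F k)) n = mu A + mu B.
  elim: n n1 => [|[|n] IH] n1 //; first lia.
  by rewrite tech5 IH; [rewrite /F mu0; ring | lia].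
by rewrite /Rdist Rminus_diag Rabs_R0.
Qed.

Lemma mu_diff (A B : R -> Prop) : is_borel A -> is_borel B ->
  (forall x, A x -> B x) -> mu (fun x => B x /\ ~ A x) = mu B - mu A.
Proof.
move=> bA bB AB.
have := @mu_or A (fun x => B x /\ ~ A x) bA (is_borel_and bB (borel_compl bA)).
have -> : (fun x => A x \/ (B x /\ ~ A x)) = B.
  by apply: pred_ext => x; split=> [[/AB|[]]//|Bx]; case: (pselect (A x)); [left|right].
by move=> ->; [ring | move=> x ? []].
Qed.

Lemma mu_mono (A B : R -> Prop) : is_borel A -> is_borel B ->
  (forall x, A x -> B x) -> mu A <= mu B.
Proof.
move=> bA bB AB; have := mu_diff bA bB AB.
have := muB.1 (fun x => B x /\ ~ A x) (is_borel_and bB (borel_compl bA)); lra.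
Qed.

Lemma mu_continuous_below (B : nat -> R -> Prop) : (forall k, is_borel (B k)) ->
  (forall k x, B k x -> B k.+1 x) ->
  Un_cv (fun k => mu (B k)) (mu (fun x => exists k, B k x)).
Proof.
move=> bB incr; have [_ [mu0 muS]] := muB.
have incr' i j x : (i <= j)%N -> B i x -> B j x.
  by move=> /subnK <-; elim: (j - i)%N => //= k IH /IH; exact: incr.
pose F k := if k is k'.+1 then fun x => B k x /\ ~ B k' x else B 0%N.
have bF k : is_borel (F k).
  by case: k => //= k; apply: is_borel_and => //; apply: borel_compl.
have FB k x : F k x -> B k x by case: k => //= k [].
have lt_dF i j x : (i < j)%N -> F i x -> F j x -> False.
  by case: j => // j; rewrite ltnS => ij /FB /(incr' _ _ _ ij) ? [].
have dF i j x : i <> j -> F i x -> F j x -> False.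
  move=> ij Fi Fj; case: (ltngtP i j) => // [H|H]; [exact: lt_dF H Fi Fj|exact: lt_dF H Fj Fi].
have := muS F bF dF.
have -> : (fun x => exists k, F k x) = (fun x => exists k, B k x).
  apply: pred_ext => x; split=> [[k /FB]|[k]]; first by exists k.
  elim: k => [|k IH] Bk; first by exists 0%N.
  by have [/IH//|nB] := pselect (B k x); exists k.+1.
move=> H eps /H[N HN]; exists N => n /HN.
suff -> : sum_f_R0 (fun k => mu (F k)) n = mu (B n) by [].
elim: n => [//|n IH]; rewrite tech5 IH /= mu_diff //; first ring.
exact: incr.
Qed.

End MeasureFacts.

(** * Identification of a measure whose values on closed rays come from a finite list *)

Section EmpiricalMeasure.
Import Coquelicot.Coquelicot.
Local Open Scope R_scope.

Lemma indic_true (A : R -> Prop) x : A x -> indic A x = 1.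
Proof. by rewrite /indic; case: excluded_middle_informative. Qed.

Lemma indic_false (A : R -> Prop) x : ~ A x -> indic A x = 0.
Proof. by rewrite /indic; case: excluded_middle_informative. Qed.

Lemma indic_or (A B : R -> Prop) x : (A x -> B x -> False) ->
  indic (fun x => A x \/ B x) x = indic A x + indic B x.
Proof.
move=> AB; have [a|a] := pselect (A x); have [b|b] := pselect (B x).
- by case: (AB a b).
- by rewrite (indic_true a) (indic_false b) indic_true; [ring|left].
- by rewrite (indic_false a) (indic_true b) indic_true; [ring|right].
- by rewrite (indic_false a) (indic_false b) indic_false; [ring|case].
Qed.

Variables (mu : (R -> Prop) -> R) (s : seq R).
Hypothesis mu_prob : probability_measure mu.
Hypothesis s0 : s <> [::].
Hypothesis mu_ray : forall r, mu (fun x => r <= x) = mean s (indic (fun x => r <= x)).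

Let muB : borel_measure mu := mu_prob.1.

Lemma mean_indic_or (A B : R -> Prop) : (forall x, A x -> B x -> False) ->
  mean s (indic (fun x => A x \/ B x)) = mean s (indic A) + mean s (indic B).
Proof.
move=> AB; rewrite -[mean s (indic A)]Rmult_1_l -mean_lin; apply: eq_in_mean => x _.
by rewrite (indic_or (AB x)) Rmult_1_l.
Qed.

(** The open ray is the increasing union of the closed rays from a + 1/(k+1). As [s] is finite, it
    has no point in a short interval to the right of [a], so the means over these rays are
    eventually constant. *)
Lemma mu_gt a : mu (fun x => a < x) = mean s (indic (fun x => a < x)).
Proof.
have [d d0 Hd] : exists2 d, 0 < d & {in s, forall x, a < x -> a + d <= x}.
  elim: s => [|y l [d d0 IH]]; first by exists 1 => //; lra.
  have [ay|ya] := Rlt_le_dec a y; last first.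
    by exists d => // x; rewrite inE => /predU1P[->|/IH//]; lra.
  exists (Rmin d (y - a)); first by apply: Rmin_glb_lt; lra.
  move=> x; rewrite inE => /predU1P[->|/IH H /H].
    by have := Rmin_r d (y - a); lra.
  by have := Rmin_l d (y - a); lra.
have := @mu_continuous_below mu muB (fun k x => a + / INR k.+1 <= x).
have -> : (fun x => exists k, a + / INR k.+1 <= x) = (fun x => a < x).
  apply: pred_ext => x; split=> [[k]|ax].
    have : 0 < / INR k.+1 by apply/Rinv_0_lt_compat/lt_0_INR; lia.
    lra.
  have e0 : 0 < x - a by lra.
  have [N [HN N0]] := archimed_cor1 _ e0.
  by exists N.-1; rewrite prednK; [lra | lia].
move=> H; apply: (UL_sequence (fun k => mu (fun x => a + / INR k.+1 <= x))).
  apply: H => [k|k x]; first exact: is_borel_ge.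
  have : / INR k.+2 <= / INR k.+1 by apply: Rinv_le_contravar; [apply: lt_0_INR; lia | apply: le_INR; lia].
  lra.
move=> eps e0; have [N [HN N0]] := archimed_cor1 _ d0.
exists N => n Nn; rewrite mu_ray.
have nd : / INR n.+1 < d.
  apply: Rle_lt_trans HN; apply: Rinv_le_contravar; [apply: lt_0_INR; lia | apply: le_INR; lia].
have n0 : 0 < / INR n.+1 by apply/Rinv_0_lt_compat/lt_0_INR; lia.
suff -> : mean s (indic (fun x => a + / INR n.+1 <= x)) = mean s (indic (fun x => a < x)).
  by rewrite /Rdist Rminus_diag Rabs_R0.
apply: eq_in_mean => x xs; have [ax|xa] := Rlt_le_dec a x.
  by rewrite !indic_true //; have := Hd x xs ax; lra.
by rewrite !indic_false //; lra.
Qed.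

Lemma mu_eq a : mu (fun x => x = a) = mean s (indic (fun x => x = a)).
Proof.
have dis x : x = a -> a < x -> False by lra.
have := @mean_indic_or (fun x => x = a) (fun x => a < x) dis.
have := mu_or muB (is_borel_eq a) (is_borel_gt a) dis.
have -> : (fun x => x = a \/ a < x) = (fun x => a <= x).
  by apply: pred_ext => x; split; lra.
rewrite mu_ray mu_gt; lra.
Qed.

Lemma mu_mem (A : R -> Prop) (l : seq R) : uniq l -> is_borel A ->
  mu (fun x => x \in l /\ A x) = mean s (indic (fun x => x \in l /\ A x)).
Proof.
move=> + bA; elim: l => [_|a l IH /= /andP[al ul]].
  have -> : (fun x => x \in [::] /\ A x) = (fun=> False) by apply: pred_ext => x; split=> // -[].
  rewrite (proj1 (proj2 muB)) -(@mean_const s 0) //; apply: eq_in_mean => x _.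
  by rewrite indic_false.
have [Aa|nAa] := pselect (A a); last first.
  have -> : (fun x => x \in a :: l /\ A x) = (fun x => x \in l /\ A x); last exact: IH.
  apply: pred_ext => x; rewrite inE; split=> -[xl Ax]; split=> //.
    by case/predU1P: xl => // xa; rewrite xa in Ax.
  by rewrite xl orbT.
have -> : (fun x => x \in a :: l /\ A x) = (fun x => x = a \/ (x \in l /\ A x)).
  apply: pred_ext => x; rewrite inE; split=> [[/predU1P[->|xl] Ax]|[->|[xl Ax]]].
  - by left.
  - by right.
  - by rewrite eqxx.
  - by rewrite xl orbT.
rewrite mu_or //; last 3 first.
- exact: is_borel_eq.
- by apply: is_borel_and => //; exact: is_borel_mem.
- by move=> x -> [xl]; rewrite xl in al.
rewrite mean_indic_or; last by move=> x -> [xl]; rewrite xl in al.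
by rewrite mu_eq IH.
Qed.

(** Its atoms show that [mu] gives mass 1 to the finite set of points of [s]. The part of [A]
    outside this set is null, and the part inside is a finite union of atoms. *)
Lemma empirical_measureE A : is_borel A -> mu A = mean s (indic A).
Proof.
move=> bA; have us := undup_uniq s.
have bT : is_borel (fun=> True) by apply: borel_open => x _; exists (mkposreal 1 Rlt_0_1).
have bS := is_borel_mem (undup s).
have mS : mu (fun x => x \in undup s) = 1.
  have := mu_mem us bT.
  have -> : (fun x => x \in undup s /\ True) = (fun x => x \in undup s).
    by apply: pred_ext => x; split=> [[]|].
  move=> ->; rewrite -[RHS](@mean_const s 1) //; apply: eq_in_mean => x xs.
  by rewrite indic_true // mem_undup.
have mSC : mu (fun x => True /\ ~ x \in undup s) = 0.
  by rewrite mu_diff // mS mu_prob.2; ring.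
have mAC : mu (fun x => A x /\ ~ x \in undup s) = 0.
  apply: Rle_antisym.
    rewrite -mSC; apply: mu_mono => //; [| |by move=> x []];
      by apply: is_borel_and => //; exact: borel_compl.
  by apply: muB.1; apply: is_borel_and => //; exact: borel_compl.
have -> : mu A = mu (fun x => (x \in undup s /\ A x) \/ (A x /\ ~ x \in undup s)).
  congr mu; apply: pred_ext => x; split=> [Ax|[[]|[]]//].
  by case: (pselect (x \in undup s)); [left|right].
rewrite mu_or //; last 3 first.
- exact: is_borel_and.
- by apply: is_borel_and => //; exact: borel_compl.
- by move=> x [? _] [].
rewrite mAC Rplus_0_r mu_mem //; apply: eq_in_mean => x xs.
have [Ax|nAx] := pselect (A x); first by rewrite !indic_true // mem_undup.
by rewrite !indic_false // => -[].
Qed.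

End EmpiricalMeasure.

(** * Integrals as limits of layered simple functions *)

Section LayerCake.
Import Coquelicot.Coquelicot.
Local Open Scope R_scope.

(** The simple function counts, with factor eps, the j in 1..J with j eps <= phi(x): for 0 <= phi(x)
    < J eps this rounds phi(x) down to a multiple of eps. *)
Fixpoint layers (phi : R -> R) (eps : R) (J : nat) : seq (R * (R -> Prop)) :=
  if J is J'.+1 then (eps, fun x => INR J * eps <= phi x) :: layers phi eps J' else [::].

Lemma simple_eval_layersS phi eps J x : simple_eval (layers phi eps J.+1) x =
  eps * indic (fun x => INR J.+1 * eps <= phi x) x + simple_eval (layers phi eps J) x.
Proof. by []. Qed.

Lemma layers_borel phi eps J : continuity phi -> 0 <= eps ->
  List.Forall (fun p => 0 <= fst p /\ is_borel (snd p)) (layers phi eps J).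
Proof.
move=> cphi e0; elim: J => [|J IH]; first exact: List.Forall_nil.
by apply: List.Forall_cons => //; split=> //; exact: is_borel_superlevel.
Qed.

Lemma layers_full phi eps J x : 0 <= eps -> INR J * eps <= phi x ->
  simple_eval (layers phi eps J) x = INR J * eps.
Proof.
move=> e0; elim: J => [|J IH] H; first by rewrite /=; ring.
rewrite simple_eval_layersS indic_true //.
rewrite S_INR in H *; rewrite IH; [ring | lra].
Qed.

Lemma layers_approx phi eps J x : 0 < eps -> 0 <= phi x < INR J * eps ->
  phi x - eps <= simple_eval (layers phi eps J) x <= phi x.
Proof.
move=> e0; elim: J => [|J IH] H; first by move: H => /=; lra.
rewrite simple_eval_layersS indic_false; last lra.
rewrite Rmult_0_r Rplus_0_l.
have [lt|ge] := Rlt_le_dec (phi x) (INR J * eps); first by apply: IH; lra.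
rewrite layers_full //; last lra.
by move: H; rewrite S_INR; lra.
Qed.

Variables (mu : (R -> Prop) -> R) (E : (R -> R) -> R).
Hypothesis E_simple : forall sf, List.Forall (fun p => 0 <= fst p /\ is_borel (snd p)) sf ->
  E (simple_eval sf) = simple_val mu sf.
Hypothesis E_lower : forall sf phi, List.Forall (fun p => 0 <= fst p /\ is_borel (snd p)) sf ->
  continuity phi -> (exists B, forall x, 0 <= phi x <= B) ->
  (forall x, simple_eval sf x <= phi x) -> E (simple_eval sf) <= E phi.
Hypothesis E_upper : forall sf phi eps,
  List.Forall (fun p => 0 <= fst p /\ is_borel (snd p)) sf ->
  continuity phi -> (exists B, forall x, 0 <= phi x <= B) -> 0 < eps ->
  (forall x, phi x <= simple_eval sf x + eps) -> E phi <= E (simple_eval sf) + eps.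

(** [E_lower] makes [E phi] an upper bound, and the layers show that it is the least one. [E] is
    abstract so as to serve for means over lists, the zero functional and expectations under an
    image of Lebesgue measure. *)
Lemma nn_integral_functional phi : continuity phi -> (exists B, forall x, 0 <= phi x <= B) ->
  nn_integral mu phi (E phi).
Proof.
move=> cphi bphi; split=> [v [sf [Hsf [le ->]]]|b Hb].
  by rewrite -E_simple //; exact: E_lower.
apply: le_epsilon => eps e0; have [B HB] := bphi.
have [J HJ] := INR_unbounded (B / eps).
have lay x : phi x - eps <= simple_eval (layers phi eps J) x <= phi x.
  apply: layers_approx => //; split; first by have := HB x; lra.
  have := HB x; have : B / eps * eps < INR J * eps by apply: Rmult_lt_compat_r.
  by rewrite (_ : B / eps * eps = B); [lra | field; lra].
have bl : List.Forall (fun p => 0 <= fst p /\ is_borel (snd p)) (layers phi eps J).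
  by apply: layers_borel => //; lra.
apply: (Rle_trans _ (E (simple_eval (layers phi eps J)) + eps)).
  by apply: E_upper => // x; have := lay x; lra.
apply: Rplus_le_compat_r; apply: Hb; exists (layers phi eps J); split=> //.
split; last exact: E_simple.
by move=> x; have := lay x; lra.
Qed.

Lemma compact_support_bounded phi : cont_compact_support phi ->
  exists B, forall x, Rabs (phi x) <= B.
Proof.
move=> [cphi [B HB]].
have [xM [HM _]] : exists xM, (forall c, - Rabs B <= c <= Rabs B -> Rabs (phi c) <= Rabs (phi xM)) /\
    - Rabs B <= xM <= Rabs B.
  apply: (continuity_ab_maj (fun x => Rabs (phi x))) => [|c _]; first by have := Rabs_pos B; lra.
  by apply: (continuity_pt_comp phi Rabs) => //; exact: Rcontinuity_abs.
exists (Rabs (phi xM)) => x; have [xB|Bx] := Rle_lt_dec (Rabs x) (Rabs B).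
  by apply: HM; apply/Rabs_le_between.
rewrite HB; first by rewrite Rabs_R0; exact: Rabs_pos.
by apply: Rle_lt_trans Bx; exact: Rle_abs.
Qed.

Lemma pos_part_continuity phi : continuity phi -> continuity (fun x => Rmax (phi x) 0).
Proof.
move=> cphi.
have -> : (fun x => Rmax (phi x) 0) = (fun x => / 2 * (phi x + Rabs (phi x))).
  by apply: funext => x; rewrite /Rmax /Rabs; case: Rle_dec; case: Rcase_abs; lra.
apply: continuity_scal; apply: (continuity_plus phi (fun x => Rabs (phi x))) => //.
by apply: (continuity_comp phi Rabs) => //; exact: Rcontinuity_abs.
Qed.

Lemma integral_functional phi : cont_compact_support phi ->
  integral mu phi (E (fun x => Rmax (phi x) 0) - E (fun x => Rmax (- phi x) 0)).
Proof.
move=> H; have [B HB] := compact_support_bounded H; have [cphi _] := H.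
have bnd psi : (forall x, Rabs (psi x) <= B) -> exists B, forall x, 0 <= Rmax (psi x) 0 <= B.
  move=> Hpsi; exists B => x; split; first exact: Rmax_r.
  by apply: Rmax_lub; have := Hpsi x; have := Rle_abs (psi x); have := Rabs_pos (psi x); lra.
exists (E (fun x => Rmax (phi x) 0)), (E (fun x => Rmax (- phi x) 0)).
split; last split=> //; apply: nn_integral_functional.
- exact: pos_part_continuity.
- exact: bnd.
- by apply: (pos_part_continuity (phi := fun x => - phi x)); exact: continuity_opp.
- by apply: bnd => x; rewrite Rabs_Ropp.
Qed.

End LayerCake.

(** * Integrals against empirical measures and the zero measure *)

Section EmpiricalIntegral.
Local Open Scope R_scope.

Lemma empirical_integral mu (s : seq R) phi : s <> [::] ->
  (forall A, is_borel A -> mu A = mean s (indic A)) -> cont_compact_support phi ->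
  integral mu phi (mean s (fun x => Rmax (phi x) 0) - mean s (fun x => Rmax (- phi x) 0)).
Proof.
move=> s0 muE; apply: (integral_functional (E := mean s)).
- elim=> [_|[c A] sf IH H]; first by rewrite [LHS]mean_const.
  inversion H as [|? ? [c0 bA] Hsf]; subst.
  by rewrite /= [LHS]mean_lin IH // muE.
- by move=> sf psi _ _ _ le; apply: mean_le => x _.
- move=> sf psi eps _ _ _ e0 le.
  rewrite -[mean s (simple_eval sf)]Rmult_1_l -[X in _ + X](@mean_const s eps) // -mean_lin.
  by apply: mean_le => x _; rewrite Rmult_1_l.
Qed.

Lemma zero_integral mu phi : (forall A, mu A = 0) -> cont_compact_support phi ->
  integral mu phi 0.
Proof.
move=> mu0 H.
have := @integral_functional mu (fun=> 0) _ _ _ phi H; rewrite Rminus_0_r; apply.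
- elim=> [//|[c A] sf IH H']; inversion H' as [|? ? _ Hsf]; subst.
  by rewrite /= -/(simple_val mu sf) -IH // mu0; ring.
- by move=> *; exact: Rle_refl.
- by move=> sf psi eps _ _ _ ? _; lra.
Qed.

End EmpiricalIntegral.

(** * Quantile functions and polygons of descending lists *)

Section StepFunctions.
Import Coquelicot.Coquelicot.
Local Open Scope R_scope.

Definition descending (s : seq R) : Prop :=
  forall i j, (i <= j)%N -> (j < size s)%N -> nth 0 s j <= nth 0 s i.

Lemma lsum_cat phi (s t : seq R) : lsum phi (s ++ t) = lsum phi s + lsum phi t.
Proof. by elim: s => [|x s IH] /=; [ring | rewrite IH; ring]. Qed.

Lemma lsum_ge0 phi (s : seq R) : {in s, forall x, 0 <= phi x} -> 0 <= lsum phi s.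
Proof. by move=> /lsum_le; rewrite lsum_const; lra. Qed.

Lemma indic_bounds (A : R -> Prop) x : 0 <= indic A x <= 1.
Proof. by rewrite /indic; case: excluded_middle_informative => ? /=; lra. Qed.

Lemma lsum_take_drop phi (s : seq R) i : lsum phi s = lsum phi (take i s) + lsum phi (drop i s).
Proof. by rewrite -lsum_cat cat_take_drop. Qed.

Lemma lsum_takeS phi (s : seq R) i : (i < size s)%N ->
  lsum phi (take i.+1 s) = lsum phi (take i s) + phi (nth 0 s i).
Proof. by move=> si; rewrite (take_nth 0 si) -cats1 lsum_cat /=; ring. Qed.

Lemma nat_interval (y : R) (w : nat) : (0 < w)%N -> 0 <= y <= INR w ->
  exists2 i, (i < w)%N & INR i <= y <= INR i + 1.
Proof.
elim: w => // -[_ _|w IH _] yw; first by exists 0%N => //; move: yw => /=; lra.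
have [H|H] := Rle_lt_dec y (INR w.+1).
  by have [//||i iw Hi] := IH; [lra | exists i => //; lia].
by exists w.+1 => //; move: yw; rewrite (S_INR w.+1); lra.
Qed.

Lemma descending_take (s : seq R) i x : descending s -> (i < size s)%N ->
  x \in take i s -> nth 0 s i <= x.
Proof.
move=> ds si /(nthP 0)[j]; rewrite size_takel; last exact: ltnW.
by move=> ji <-; rewrite nth_take //; apply: ds => //; exact: ltnW.
Qed.

Lemma descending_drop (s : seq R) i x : descending s ->
  x \in drop i s -> x <= nth 0 s i.
Proof.
move=> ds /(nthP 0)[j]; rewrite size_drop ltn_subRL => ji <-; rewrite nth_drop.
by apply: ds => //; exact: leq_addr.
Qed.

Lemma is_lub_below a (E : R -> Prop) : (forall x, E x <-> x < a) -> is_lub E a.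
Proof.
move=> EE; split=> [x /EE|b Hb]; first lra.
have [//|ba] := Rle_lt_dec a b.
have : (a + b) / 2 <= b by apply: Hb; apply/EE; lra.
lra.
Qed.

Lemma Rsup_lub E l : is_lub E l -> Rsup E = l.
Proof.
move=> H; rewrite /Rsup; case: excluded_middle_informative => [e|]; last by case; exists l.
case: ClassicalEpsilon.constructive_indefinite_description => l' /= H'; exact: is_lub_u H' H.
Qed.

Lemma Defs_RInt_is_RInt f a b v : is_RInt f a b v -> Defs.RInt f a b = v.
Proof.
move=> H; rewrite /Defs.RInt; case: excluded_middle_informative => [e|ne].
  case: ClassicalEpsilon.constructive_indefinite_description => pr _ /=.
  by rewrite -RInt_Reals; exact: is_RInt_unique.
case: ne; have pr : Riemann_integrable f a b by apply: ex_RInt_Reals_0; exists v.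
by exists pr.
Qed.

Variables (nu : (R -> Prop) -> R) (s : seq R).
Hypothesis s0 : s <> [::].
Hypothesis ds : descending s.
Hypothesis nuE : forall a, nu (fun x => a < x) = mean s (indic (fun x => a < x)).

Local Notation w := (INR (size s)).

Let w0 : 0 < w := size_INR_pos s0.

(** In a descending list the points above [x] form a prefix. *)
Lemma lsum_indic_gt i x : (i < size s)%N ->
  (INR i < lsum (indic (fun y => x < y)) s) <-> x < nth 0 s i.
Proof.
move=> si; split=> H; last first.
  rewrite (lsum_take_drop _ _ i.+1).
  have -> : lsum (indic (fun y => x < y)) (take i.+1 s) = INR i.+1.
    rewrite (eq_in_lsum (psi := fun=> 1)) => [|y yt].
      by rewrite lsum_const size_takel // Rmult_1_l.
    rewrite indic_true //; move: yt; rewrite (take_nth 0 si) mem_rcons inE.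
    move=> /predU1P[->//|/(descending_take ds si)]; lra.
  have : 0 <= lsum (indic (fun y => x < y)) (drop i.+1 s).
    by apply: lsum_ge0 => y _; have := indic_bounds (fun y => x < y) y; lra.
  by rewrite S_INR; lra.
have [//|le] := Rlt_le_dec x (nth 0 s i); move: H; rewrite (lsum_take_drop _ _ i).
have : lsum (indic (fun y => x < y)) (take i s) <= lsum (fun=> 1) (take i s).
  by apply: lsum_le => y _; have := indic_bounds (fun y => x < y) y; lra.
rewrite lsum_const size_takel; last exact: ltnW.
have -> : lsum (indic (fun y => x < y)) (drop i s) = lsum (fun=> 0) (drop i s).
  by apply: eq_in_lsum => y /(descending_drop ds) yi; rewrite indic_false //; lra.
rewrite lsum_const; lra.
Qed.

Lemma lsum_indic_nat (A : R -> Prop) (l : seq R) : exists k, lsum (indic A) l = INR k.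
Proof.
elim: l => [|x l [k IH]]; first by exists 0%N.
have [a|a] := pselect (A x); rewrite [lsum _ _]/= -/(lsum _ _) IH.
  by exists k.+1; rewrite indic_true // S_INR; ring.
by exists k; rewrite indic_false //; ring.
Qed.

(** The tail at [x] is k / w with [k] an integer, and i <= t w < i + 1, so it exceeds [t] exactly
    when k > i, that is, when [x] is below the i-th point. *)
Lemma Fstar_step i t : (i < size s)%N -> INR i / w <= t < (INR i + 1) / w ->
  Fstar nu t = nth 0 s i.
Proof.
move=> si [it ti]; apply/Rsup_lub/is_lub_below => x.
rewrite /tailF nuE -lsum_indic_gt // /mean.
have iw : INR i / w * w = INR i by field; lra.
have iw' : (INR i + 1) / w * w = INR i + 1 by field; lra.
have itw : INR i <= t * w by rewrite -iw; apply: Rmult_le_compat_r; lra.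
have tiw : t * w < INR i + 1 by rewrite -iw'; apply: Rmult_lt_compat_r; lra.
have [k Hk] := lsum_indic_nat (fun y => x < y) s.
have kw : INR k / w * w = INR k by field; lra.
rewrite Hk; split=> [H|/INR_lt ik].
  by have : t * w < INR k by [rewrite -kw; apply: Rmult_lt_compat_r; lra]; lra.
have ik' : INR i + 1 <= INR k by rewrite -S_INR; apply: le_INR; lia.
apply: (Rmult_lt_reg_r w) => //; lra.
Qed.

Lemma is_RInt_Fstar_piece i a b : (i < size s)%N -> INR i / w <= a -> a <= b ->
  b <= (INR i + 1) / w -> is_RInt (Fstar nu) a b ((b - a) * nth 0 s i).
Proof.
move=> si ia ab bi; apply: (is_RInt_ext (fun=> nth 0 s i)); last exact: is_RInt_const.
move=> t; rewrite Rmin_left // Rmax_right // => tab.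
by rewrite (Fstar_step si) //; lra.
Qed.

Lemma is_RInt_Fstar_prefix i : (i <= size s)%N ->
  is_RInt (Fstar nu) 0 (INR i / w) (lsum id (take i s) / w).
Proof.
elim: i => [|i IH] si.
  by rewrite take0 /= /Rdiv !Rmult_0_l; exact: is_RInt_point.
have -> : lsum id (take i.+1 s) / w =
    lsum id (take i s) / w + (INR i.+1 / w - INR i / w) * nth 0 s i.
  by rewrite lsum_takeS // S_INR; field; lra.
apply: (is_RInt_Chasles _ _ (INR i / w)); first by apply/IH/ltnW.
apply: is_RInt_Fstar_piece => //; rewrite ?S_INR; first lra.
  by apply: Rmult_le_compat_r; [apply/Rlt_le/Rinv_0_lt_compat | lra].
lra.
Qed.

Lemma polygonE i t : (i < size s)%N -> INR i / w <= t <= (INR i + 1) / w ->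
  polygon nu t = lsum id (take i s) / w + (t - INR i / w) * nth 0 s i.
Proof.
move=> si [it ti]; apply: Defs_RInt_is_RInt.
apply: (is_RInt_Chasles _ _ (INR i / w)); first exact/is_RInt_Fstar_prefix/ltnW.
by apply: is_RInt_Fstar_piece => //; lra.
Qed.

Definition hinge (c x : R) : R := Rmax (x - c) 0.

Lemma polygon_interval t : 0 <= t <= 1 ->
  exists2 i, (i < size s)%N & INR i / w <= t <= (INR i + 1) / w.
Proof.
move=> t01; have [||i si Hi] := @nat_interval (t * w) (size s).
- by case: (s) s0.
- split; first by apply: Rmult_le_pos; lra.
  by rewrite -[X in _ <= X]Rmult_1_l; apply: Rmult_le_compat_r; lra.
exists i => //; split; apply: (Rmult_le_reg_r w) => //.
  by rewrite (_ : INR i / w * w = INR i); [lra | field; lra].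
by rewrite (_ : (INR i + 1) / w * w = INR i + 1); [lra | field; lra].
Qed.

Lemma lsum_shift c (l : seq R) : lsum (fun x => x - c) l = lsum id l - c * INR (size l).
Proof.
have E (x : R) : x = 1 * (x - c) + c by ring.
have -> : lsum id l = lsum (fun x => 1 * (x - c) + c) l.
  by apply: eq_in_lsum => x _; exact: E.
by rewrite lsum_lin lsum_const; ring.
Qed.

(* The concave polygon is the lower envelope of the lines [c t + mean (x - c)_+]. *)
Lemma polygon_le t c : 0 <= t <= 1 -> polygon nu t <= c * t + mean s (hinge c).
Proof.
move=> t01; have [i si Hi] := polygon_interval t01; rewrite (polygonE si Hi).
have S1 : lsum (fun x => x - c) (take i s) <= lsum (hinge c) (take i s).
  by apply: lsum_le => x _; exact: Rmax_l.
have S2 : 0 <= lsum (hinge c) (drop i.+1 s).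
  by apply: lsum_ge0 => x _; exact: Rmax_r.
rewrite lsum_shift size_takel in S1; last by lia.
have h0 : 0 <= hinge c (nth 0 s i) by exact: Rmax_r.
have h1 : nth 0 s i - c <= hinge c (nth 0 s i) by exact: Rmax_l.
have tw : 0 <= t * w - INR i <= 1.
  have iw : INR i / w * w = INR i by field; lra.
  have iw' : (INR i + 1) / w * w = INR i + 1 by field; lra.
  have := Rmult_le_compat_r w _ _ (Rlt_le _ _ w0) (proj1 Hi).
  have := Rmult_le_compat_r w _ _ (Rlt_le _ _ w0) (proj2 Hi).
  by rewrite iw iw'; lra.
(* Up to the factor w, the polygon at [t] takes the points before [i] in full and the fraction t w -
   i, which lies in [0, 1], of the i-th point. *)
have P : (t * w - INR i) * (nth 0 s i - c) <= hinge c (nth 0 s i).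
  move: tw h0 h1; clear; set u := _ - INR i; set h := hinge _ _; set z := _ - c; nra.
rewrite /mean (lsum_take_drop (hinge c) s i.+1) lsum_takeS //.
apply: (Rmult_le_reg_r w) => //.
have -> : (lsum id (take i s) / w + (t - INR i / w) * nth 0 s i) * w =
  lsum id (take i s) + (t * w - INR i) * nth 0 s i by field; lra.
set S := lsum (hinge c) (take i s) + _ + _.
have -> : (c * t + S / w) * w = c * (t * w) + S by field; lra.
rewrite /S; lra.
Qed.

(** The minimizing [c] is the point whose step contains [t]: (x - c)_+ is x - c on the points before
    it and 0 from it on. *)
Lemma polygon_eq t : 0 <= t <= 1 ->
  exists2 c, c \in s & polygon nu t = c * t + mean s (hinge c).
Proof.
move=> t01; have [i si Hi] := polygon_interval t01; rewrite (polygonE si Hi).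
exists (nth 0 s i); first exact: mem_nth.
rewrite /mean (lsum_take_drop (hinge _) s i).
have -> : lsum (hinge (nth 0 s i)) (take i s) = lsum (fun x => x - nth 0 s i) (take i s).
  by apply: eq_in_lsum => x /(descending_take ds si) H; rewrite /hinge Rmax_left //; lra.
have -> : lsum (hinge (nth 0 s i)) (drop i s) = lsum (fun=> 0) (drop i s).
  by apply: eq_in_lsum => x /(descending_drop ds) H; rewrite /hinge Rmax_right //; lra.
rewrite lsum_shift lsum_const size_takel; last exact: ltnW.
by field; lra.
Qed.

End StepFunctions.

(** * Uniform convergence of the polygons *)

Section PolygonConvergence.
Import Coquelicot.Coquelicot.
Local Open Scope R_scope.

Lemma hinge_continuity c : continuity (hinge c).
Proof.
apply: (pos_part_continuity (phi := fun x => x - c)).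
apply: (continuity_minus id (fun=> c)); first exact: derivable_continuous derivable_id.
by apply: continuity_const.
Qed.

Lemma hinge_lipschitz c c' x : Rabs (hinge c x - hinge c' x) <= Rabs (c - c').
Proof.
rewrite /hinge /Rmax /Rabs.
by case: Rle_dec; case: Rle_dec; case: Rcase_abs; case: Rcase_abs; lra.
Qed.

Variables (s : nat -> seq R) (nu : nat -> (R -> Prop) -> R) (C : R) (N0 : nat).
Hypothesis C0 : 0 < C.
Hypothesis s_neq0 : forall n, (N0 <= n)%N -> s n <> [::].
Hypothesis s_bound : forall n, (N0 <= n)%N -> {in s n, forall x, Rabs x <= C}.
Hypothesis s_desc : forall n, (N0 <= n)%N -> descending (s n).
Hypothesis s_cv : forall phi, continuity phi -> cvmean s phi.
Hypothesis nuE : forall n, (N0 <= n)%N -> forall a,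
  nu n (fun x => a < x) = mean (s n) (indic (fun x => a < x)).

Lemma hinge_means_cauchy_net eps d J : 0 < eps -> exists N, forall n k j,
  (N <= n)%N -> (N <= k)%N -> (j <= J)%N ->
  Rabs (mean (s n) (hinge (- C + INR j * d)) - mean (s k) (hinge (- C + INR j * d))) < eps.
Proof.
move=> e0.
have one j : exists N, forall n k, (N <= n)%N -> (N <= k)%N ->
    Rabs (mean (s n) (hinge (- C + INR j * d)) - mean (s k) (hinge (- C + INR j * d))) < eps.
  have [l Hl] := s_cv (hinge_continuity (- C + INR j * d)).
  have [N HN] := CV_Cauchy _ (exist _ l Hl) _ e0.
  by exists N => n k Hn Hk; apply: HN; lia.
elim: J => [|J [N IH]].
  by have [N HN] := one 0%N; exists N => n k j Hn Hk; rewrite leqn0 => /eqP ->; exact: HN.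
have [M HM] := one J.+1; exists (N + M)%N => n k j Hn Hk.
rewrite leq_eqVlt => /predU1P[->|jJ]; first by apply: HM; lia.
by apply: IH; lia.
Qed.

(** Means of [hinge c] are 1-Lipschitz in [c], so a net of [-C, C] of mesh eps/3 suffices. *)
Lemma hinge_means_uniformly_cauchy eps : 0 < eps -> exists N, forall n k c,
  (N <= n)%N -> (N <= k)%N -> Rabs c <= C ->
  Rabs (mean (s n) (hinge c) - mean (s k) (hinge c)) < eps.
Proof.
move=> e0; have d0 : 0 < eps / 3 by lra.
have [J HJ] := INR_unbounded (2 * C / (eps / 3)).
have J0 : (0 < J)%N.
  case: J HJ => // /=; have : 0 < 2 * C / (eps / 3) by apply: Rdiv_lt_0_compat; lra.
  lra.
have [N HN] := @hinge_means_cauchy_net _ (eps / 3) J d0.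
exists (N0 + N)%N => n k c Hn Hk /Rabs_le_between cC.
have [||j jJ Hj] := @nat_interval ((c + C) / (eps / 3)) J => //.
  split; first by apply: Rmult_le_pos; [lra | apply/Rlt_le/Rinv_0_lt_compat].
  apply: Rle_trans (Rlt_le _ _ HJ); apply: Rmult_le_compat_r; last lra.
  exact/Rlt_le/Rinv_0_lt_compat.
have close : Rabs (c - (- C + INR j * (eps / 3))) <= eps / 3.
  have E : (c + C) / (eps / 3) * (eps / 3) = c + C by field; lra.
  have := Rmult_le_compat_r _ _ _ (Rlt_le _ _ d0) (proj1 Hj).
  have := Rmult_le_compat_r _ _ _ (Rlt_le _ _ d0) (proj2 Hj).
  by rewrite E => H1 H2; apply: Rabs_le; lra.
have near i : (N0 <= i)%N ->
    Rabs (mean (s i) (hinge c) - mean (s i) (hinge (- C + INR j * (eps / 3)))) <= eps / 3.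
  move=> Hi; apply: mean_close; first exact: s_neq0.
  by move=> x _; apply: Rle_trans (hinge_lipschitz _ _ _) close.
have /Rabs_le_between H1 := near n ltac:(lia).
have /Rabs_le_between H2 := near k ltac:(lia).
have /Rabs_lt_between H3 := HN n k j ltac:(lia) ltac:(lia) ltac:(lia).
by apply/Rabs_lt_between; lra.
Qed.

(** One polygon is bounded by the line that is tight for the other at [t], at the cost of the
    difference of two hinge means. The parameter of that line is a point of a list, hence lies in
    [-C, C]. *)
Lemma polygons_uniformly_cauchy eps : 0 < eps -> exists N, forall n k t,
  (N <= n)%N -> (N <= k)%N -> 0 <= t <= 1 ->
  Rabs (polygon (nu n) t - polygon (nu k) t) < eps.
Proof.
move=> e0; have [N HN] := hinge_means_uniformly_cauchy e0.
exists (N0 + N)%N => n k t Hn Hk t01.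
have half i j : (N0 + N <= i)%N -> (N0 + N <= j)%N ->
    polygon (nu i) t - polygon (nu j) t < eps.
  move=> Hi Hj.
  have i0 : (N0 <= i)%N by lia. have j0 : (N0 <= j)%N by lia.
  have [c cs ->] := polygon_eq (s_neq0 j0) (s_desc j0) (nuE j0) t01.
  have := polygon_le (s_neq0 i0) (s_desc i0) (nuE i0) c t01.
  have /Rabs_lt_between := HN i j c ltac:(lia) ltac:(lia) (s_bound j0 cs).
  lra.
have := half n k Hn Hk; have := half k n Hk Hn => H1 H2.
by apply/Rabs_lt_between; lra.
Qed.

Theorem polygons_cv : exists g : R -> R, concave_on01 g /\
  forall eps : R, eps > 0 -> exists N : nat, forall n : nat, le N n ->
    forall t : R, 0 <= t <= 1 -> Rabs (polygon (nu n) t - g t) < eps.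
Proof.
have lim t : exists l, 0 <= t <= 1 -> Un_cv (fun n => polygon (nu n) t) l.
  have [t01|nt] := pselect (0 <= t <= 1); last by exists 0.
  have H : Cauchy_crit (fun n => polygon (nu n) t).
    move=> eps /polygons_uniformly_cauchy[N HN]; exists N => n k Hn Hk.
    by apply: HN => //; lia.
  by have [l Hl] := Rcomplete.R_complete _ H; exists l.
have [g Hg] := choice lim.
have unif eps : eps > 0 -> exists N : nat, forall n : nat, le N n ->
    forall t : R, 0 <= t <= 1 -> Rabs (polygon (nu n) t - g t) < eps.
  move=> e0; have e2 : 0 < eps / 2 by lra.
  have [N HN] := polygons_uniformly_cauchy e2; exists N => n Hn t t01.
  have [M HM] := Hg t t01 _ e2.
  have /Rabs_lt_between H1 := HM (M + N)%N ltac:(lia).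
  have /Rabs_lt_between H2 := HN n (M + N)%N t ltac:(lia) ltac:(lia) t01.
  by apply/Rabs_lt_between; lra.
exists g; split=> // x y l x01 y01 l01; apply: le_epsilon => eps e0.
have e2 : eps / 2 > 0 by lra.
have [N HN] := unif _ e2; set n := (N + N0)%N.
have z01 : 0 <= l * x + (1 - l) * y <= 1 by move: x01 y01 l01; clear; nra.
have n0 : (N0 <= n)%N by rewrite /n; lia.
have nN : le N n by rewrite /n; lia.
(* The line tight at the intermediate point bounds the same polygon at [x] and at [y]; replacing the
   polygon by [g] costs eps/2 on each side. *)
have [c _ Hz] := polygon_eq (s_neq0 n0) (s_desc n0) (nuE n0) z01.
have Hx := polygon_le (s_neq0 n0) (s_desc n0) (nuE n0) c x01.
have Hy := polygon_le (s_neq0 n0) (s_desc n0) (nuE n0) c y01.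
have /Rabs_lt_between Gx := HN n nN _ x01.
have /Rabs_lt_between Gy := HN n nN _ y01.
have /Rabs_lt_between Gz := HN n nN _ z01.
have Kx := Rmult_le_compat_l l (g x) (c * x + mean (s n) (hinge c) + eps / 2)
  (proj1 l01) ltac:(lra).
have Ky := Rmult_le_compat_l (1 - l) (g y) (c * y + mean (s n) (hinge c) + eps / 2)
  ltac:(lra) ltac:(lra).
nra.
Qed.

End PolygonConvergence.

(** * Images of Lebesgue measure on the unit interval *)

Section LebesgueUnitInterval.
Import mathcomp.classical.all_classical mathcomp.reals.all_reals.
Import mathcomp.analysis.all_analysis mathcomp.analysis.measurable_realfun.
Import numFieldNormedType.Exports.
Local Open Scope classical_set_scope.
Variable R : realType.
Local Notation mu := (@lebesgue_measure R).
Local Notation D := (`[0%R, 1%R[%classic : set R).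

(** The half-open interval is the disjoint union of the steps [i/w, (i+1)/w[ on which a quantile
    function is constant. *)
Definition expect (q phi : R -> R) : R := (\int[mu]_(t in D) phi (q t))%R.
Definition lebesgue_push (q : R -> R) (A : set R) : R := fine (mu (D `&` q @^-1` A)).

Let mD : measurable D. Proof. exact: measurable_itv. Qed.

Let mu_itvco (a b : R) : a <= b -> mu (`[a, b[%classic : set R) = (b - a)%:E.
Proof.
move=> ab; rewrite lebesgue_measure_itv /= lte_fin; case: ltP => // ba.
by rewrite (@le_anti _ _ a b) ?ab ?ba // subrr.
Qed.

Let muD : mu D = 1%:E.
Proof. by rewrite mu_itvco ?ler01 // subr0. Qed.

Lemma elementary_open_measurable (A : set R) :
  (forall x, A x -> exists2 e, 0 < e & forall y, `|y - x| < e -> A y) -> measurable A.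
Proof.
move=> H; apply: open_measurable; rewrite openE => x /H[e e0 He].
by exists e => //= y /=; rewrite /ball_ /= distrC => /He.
Qed.

Lemma superlevel_measurable (phi : R -> R) :
  (forall r, measurable [set x | r <= phi x]) -> measurable_fun setT phi.
Proof.
move=> H; apply: (measurability (@RGenCInfty.G R)) => [|/= _ [_] [r] -> <-].
  exact: RGenCInfty.measurableE.
by rewrite setTI (_ : _ @^-1` _ = [set x | r <= phi x]) //;
  apply/seteqP; split=> x /=; rewrite in_itv /= andbT.
Qed.

(** The preimage of an upper ray is an interval. *)
Lemma nonincreasing_on_measurable (q : R -> R) :
  (forall s t, D s -> D t -> s <= t -> q t <= q s) -> measurable_fun D q.
Proof.
move=> H; apply: (measurability (@RGenCInfty.G R)) => [|/= _ [_] [r] -> <-].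
  exact: RGenCInfty.measurableE.
apply: is_interval_measurable => s t /= [Ds rs] [Dt rt] u /andP[su ut].
have Du : D u.
  move: Ds Dt; rewrite /= !in_itv /= => /andP[s0 s1] /andP[t0 t1].
  by rewrite (le_trans s0 su) (le_lt_trans ut t1).
split=> //; move: rs rt; rewrite !in_itv /= !andbT => rs rt.
exact: le_trans rt (H _ _ Du Dt ut).
Qed.

(** A class containing both the bounded continuous functions and the simple functions over Borel
    sets, and integrable after composition with any measurable [q]. *)
Definition bounded_measurable (phi : R -> R) : Prop :=
  measurable_fun setT phi /\ exists B, forall x, `|phi x| <= B.

Lemma bounded_measurable_cst c : bounded_measurable (fun=> c).
Proof. by split; [exact: measurable_cst | exists `|c|]. Qed.

Lemma bounded_measurable_lin a phi psi : bounded_measurable phi ->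
  bounded_measurable psi -> bounded_measurable (fun x => a * phi x + psi x).
Proof.
move=> [mphi [B HB]] [mpsi [B' HB']]; split.
  by apply: measurable_funD => //; apply: measurable_funM => //; exact: measurable_cst.
exists (`|a| * B + B') => x; rewrite (le_trans (ler_normD _ _)) // normrM.
by rewrite lerD // ler_wpM2l.
Qed.

Lemma bounded_measurable_indic (A : set R) : measurable A -> bounded_measurable (\1_A).
Proof.
move=> mA; split; first exact: measurable_indic.
by exists 1 => x; rewrite indicE; case: (x \in A); rewrite ?normr1 ?normr0 // ler01.
Qed.

Section Expectation.
Variable q : R -> R.
Hypothesis mq : measurable_fun D q.

Lemma expect_integrable phi : bounded_measurable phi ->
  mu.-integrable D (EFin \o (fun t => phi (q t))).
Proof.
move=> [mphi [B HB]]; apply: measurable_bounded_integrable => //.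
- by rewrite [X in (X < _)%E]muD ltry.
- exact: measurableT_comp.
- exists B; split; first by rewrite num_real.
  by move=> M BM t Dt; apply: le_trans (HB _) (ltW BM).
Qed.

Lemma expect_lin a phi psi : bounded_measurable phi -> bounded_measurable psi ->
  expect q (fun x => a * phi x + psi x) = a * expect q phi + expect q psi.
Proof.
move=> bphi bpsi; rewrite /expect RintegralD //; last 2 first.
- have := bounded_measurable_lin a bphi (bounded_measurable_cst 0).
  by under eq_fun do rewrite addr0; exact: expect_integrable.
- exact: expect_integrable.
by rewrite RintegralZl //; exact: expect_integrable.
Qed.

Lemma expect_le phi psi : bounded_measurable phi -> bounded_measurable psi ->
  (forall x, phi x <= psi x) -> expect q phi <= expect q psi.
Proof.
move=> bphi bpsi le; apply: le_Rintegral => //; exact: expect_integrable.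
Qed.

Lemma expect_cst c : expect q (fun=> c) = c.
Proof. by rewrite /expect Rintegral_cst // [X in fine X]muD /= mulr1. Qed.

Lemma lebesgue_push_measurable A : measurable A -> measurable (D `&` q @^-1` A).
Proof. by move=> mA; exact: mq. Qed.

Lemma lebesgue_push_fin A : measurable A -> mu (D `&` q @^-1` A) \is a fin_num.
Proof.
move=> mA; rewrite ge0_fin_numE //; apply: (@le_lt_trans _ _ (mu D)).
  by apply: le_measure; rewrite ?inE //; exact: lebesgue_push_measurable.
by rewrite muD ltry.
Qed.

Lemma expect_indic (A : set R) : measurable A -> expect q (\1_A) = lebesgue_push q A.
Proof.
move=> mA; rewrite /expect /Rintegral /lebesgue_push; congr fine.
rewrite -[in RHS](setIidr (@subIsetl _ D (q @^-1` A))) setIC.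
rewrite -(@integral_indic _ _ _ mu D mD); last exact: lebesgue_push_measurable.
apply: eq_integral => t Dt; rewrite !indicE; congr ((nat_of_bool _)%:R%:E).
by move: Dt; rewrite inE => Dt; apply/idP/idP => [/set_mem At|/set_mem[_ At]]; exact: mem_set.
Qed.

Lemma lebesgue_push_ge0 A : 0 <= lebesgue_push q A.
Proof. exact: fine_ge0. Qed.

Lemma lebesgue_push0 : lebesgue_push q set0 = 0.
Proof. by rewrite /lebesgue_push preimage_set0 setI0 measure0. Qed.

Lemma lebesgue_pushT : lebesgue_push q setT = 1.
Proof. by rewrite /lebesgue_push preimage_setT setIT [X in fine X]muD. Qed.

(** Preimages preserve disjoint unions. The conclusion has the eps form to which [infinite_sum]
    unfolds. *)
Lemma lebesgue_push_sigma_additive (F : nat -> set R) :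
  (forall k, measurable (F k)) -> (forall i j x, i <> j -> F i x -> F j x -> False) ->
  forall e, 0 < e -> exists N, forall n, (N <= n)%N ->
    `|\sum_(0 <= i < n) lebesgue_push q (F i) - lebesgue_push q (\bigcup_i F i)| < e.
Proof.
move=> mF dF e e0.
pose G k := D `&` q @^-1` (F k).
have mG k : measurable (G k) by exact: lebesgue_push_measurable.
have UG : \bigcup_k G k = D `&` q @^-1` (\bigcup_k F k).
  by rewrite preimage_bigcup setI_bigcupr.
have tG : trivIset setT G.
  move=> i j _ _ [x [[_ xi] [_ xj]]]; apply: contrapT => ij.
  exact: dF ij xi xj.
have mUF : measurable (\bigcup_k F k) by exact: bigcup_measurable.
have UE : mu (\bigcup_k G k) = (lebesgue_push q (\bigcup_k F k))%:E.
  by rewrite UG /lebesgue_push fineK //; exact: lebesgue_push_fin.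
have : (fun n => \sum_(0 <= i < n) mu (G i))%E @ \oo --> (lebesgue_push q (\bigcup_k F k))%:E.
  by rewrite -UE; exact: measure_sigma_additive.
move=> /fine_cvg H.
have {}H : (fun n => \sum_(0 <= i < n) lebesgue_push q (F i)) @ \oo -->
    lebesgue_push q (\bigcup_k F k).
  apply: cvg_trans H; apply: near_eq_cvg; apply: nearW => n /=.
  rewrite (_ : (\sum_(0 <= i < n) mu (G i))%E = (\sum_(0 <= i < n) lebesgue_push q (F i))%:E) //.
  rewrite -sumEFin; apply: eq_bigr => i _; rewrite /lebesgue_push fineK //.
  exact: lebesgue_push_fin.
move/cvgrPdist_lt: H => /(_ e e0)[N _ HN].
by exists N => n Nn; rewrite distrC; exact: HN.
Qed.

Lemma expect_step (w : nat) (x : nat -> R) phi : (0 < w)%N -> bounded_measurable phi ->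
  (forall i t, (i < w)%N -> i%:R / w%:R <= t -> t < i.+1%:R / w%:R -> q t = x i) ->
  expect q phi = (\sum_(i < w) phi (x i)) / w%:R.
Proof.
move=> w0 bphi qx; have w0' : 0 < w%:R :> R by rewrite ltr0n.
have wi (i j : nat) : (i <= j)%N -> i%:R / w%:R <= j%:R / w%:R :> R.
  by move=> ij; rewrite ler_pM2r ?invr_gt0 // ler_nat.
suff H i : (i <= w)%N ->
    (\int[mu]_(t in (`[0%R, (i%:R / w%:R)%R[%classic : set R)) phi (q t))%R =
    (\sum_(j < i) phi (x j)) / w%:R.
  by have := H w (leqnn w); rewrite divff ?gt_eqF.
elim: i => [_|i IH iw].
  by rewrite mul0r set_itvco0 Rintegral_set0 big_ord0 mul0r.
have E : (`[0%R, (i.+1%:R / w%:R)%R[%classic : set R) =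
    (`[0%R, (i%:R / w%:R)%R[%classic : set R) `|` (`[(i%:R / w%:R)%R, (i.+1%:R / w%:R)%R[%classic : set R).
  apply/seteqP; split=> t /=; rewrite !in_itv /=.
    by move=> /andP[t0 ti]; rewrite t0 ti andbT /=; case: leP; [right|left].
  case=> /andP[t0 ti].
    by rewrite t0 (lt_le_trans ti (wi _ _ (leqnSn i))).
  by rewrite ti andbT (le_trans _ t0) // divr_ge0.
rewrite E Rintegral_setU //; last 2 first.
- rewrite -E; apply: integrableS (expect_integrable bphi) => //.
  move=> t /=; rewrite !in_itv /= => /andP[-> ti] /=.
  by apply: lt_le_trans ti _; have := wi _ _ iw; rewrite divff ?gt_eqF.
- apply/disj_setPS => t /=; rewrite !in_itv /= => -[/andP[_ ti] /andP[it _]].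
  by move: (lt_le_trans ti it); rewrite ltxx.
rewrite IH; last exact: ltnW.
rewrite big_ord_recr /= mulrDl; congr (_ + _).
rewrite (@eq_Rintegral _ _ _ _ _ (fun=> phi (x i))); last first.
  by move=> t; rewrite inE /= in_itv /= => /andP[it ti]; rewrite (qx i).
rewrite Rintegral_cst // [X in fine X](mu_itvco (wi _ _ (leqnSn i))) /= -mulrBl -natrB // subSnn mul1r.
by [].
Qed.

End Expectation.

(** Dominated convergence with a constant bound of |phi|; a countable set is Lebesgue null. *)
Lemma expect_cvg (qn : nat -> R -> R) (q : R -> R) (phi : R -> R) (Z : set R) :
  (forall n, measurable_fun D (qn n)) -> measurable_fun D q -> bounded_measurable phi ->
  countable Z ->
  (forall t, D t -> ~ Z t -> forall e, 0 < e -> exists N, forall n, (N <= n)%N ->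
     `|phi (qn n t) - phi (q t)| < e) ->
  forall e, 0 < e -> exists N, forall n, (N <= n)%N ->
    `|expect (qn n) phi - expect q phi| < e.
Proof.
move=> mqn mq bphi cZ cv e e0; have [mphi [B HB]] := bphi.
have iq n := expect_integrable (mqn n) bphi.
have B0 : 0 <= B by apply: le_trans (HB 0).
have [] := @dominated_convergence _ _ _ mu D mD
   (fun n t => (phi (qn n t))%:E) (fun t => (phi (q t))%:E) (cst B%:E).
- by move=> n; exact: measurable_int (iq n).
- exact: measurable_int (expect_integrable mq bphi).
- exists Z; split.
  + exact: countable_measurable.
  + exact: countable_lebesgue_measure0.
  + move=> t /= H; apply: contrapT => nZ; apply: H => Dt.
    apply/cvg_EFin; first by apply: nearW.
    apply/cvgrPdist_lt => d d0; have [N HN] := cv t Dt nZ d d0.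
    by exists N => // n /= Nn; rewrite distrC; exact: HN.
- apply: measurable_bounded_integrable => //.
  + by rewrite [X in (X < _)%E]muD ltry.
  + exists B; split; first by rewrite num_real.
    by move=> M BM t Dt; rewrite /= ger0_norm // ltW.
- by apply: aeW => t n Dt /=; rewrite lee_fin.
move=> iphi _ H.
have {}H : (fun n => expect (qn n) phi) @ \oo --> expect q phi.
  have F : (\int[mu]_(t in D) (phi (q t))%:E)%E \is a fin_num.
    by apply: integrable_fin_num.
  by move: H; rewrite -(fineK F) => /fine_cvg.
move/cvgrPdist_lt: H => /(_ e e0)[N _ HN].
by exists N => n Nn; rewrite distrC; exact: HN.
Qed.

End LebesgueUnitInterval.

(** * Monotonicity and tails of the quantiles of a list *)

Section Quantile.
Local Open Scope R_scope.
Variable l : seq R.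
Hypothesis l0 : l <> [::].
Hypothesis dl : descending l.

Definition quantile (l : seq R) (t : R) : R := Fstar (fun A => mean l (indic A)) t.

Lemma quantile_nth i t : (i < size l)%N ->
  INR i / INR (size l) <= t < (INR i + 1) / INR (size l) -> quantile l t = nth 0 l i.
Proof. by move=> il it; apply: Fstar_step. Qed.

(** [polygon_interval] gives closed steps; a right endpoint is handed to the next step, which exists
    because t < 1. *)
Lemma quantile_index t : 0 <= t < 1 -> exists2 i, (i < size l)%N &
  INR i / INR (size l) <= t < (INR i + 1) / INR (size l).
Proof.
move=> t01; have w0 := size_INR_pos l0.
have t01' : 0 <= t <= 1 by lra.
have [i il [it ti]] := polygon_interval l0 t01'.
have [lt|ge] := Rlt_le_dec t ((INR i + 1) / INR (size l)); first by exists i.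
have tE : t = INR i.+1 / INR (size l) by rewrite S_INR; lra.
have il' : (i.+1 < size l)%N.
  apply/ssrnat.ltP/INR_lt; have : t * INR (size l) < 1 * INR (size l) by apply: Rmult_lt_compat_r; lra.
  by rewrite tE (_ : _ / _ * _ = INR i.+1); [lra | field; lra].
exists i.+1 => //; rewrite tE; split; first lra.
by apply: Rmult_lt_compat_r; [exact: Rinv_0_lt_compat | lra].
Qed.

Lemma quantile_mem t : 0 <= t < 1 -> quantile l t \in l.
Proof. by move=> /quantile_index[i il it]; rewrite (quantile_nth il it); exact: mem_nth. Qed.

(** The Galois correspondence between quantile and tail, through which limits of tails control
    limits of quantiles. *)
Lemma quantile_gt a t : 0 <= t < 1 ->
  a < quantile l t <-> t < mean l (indic (fun x => a < x)).
Proof.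
move=> /quantile_index[i il it]; rewrite (quantile_nth il it) -lsum_indic_gt // /mean.
have w0 := size_INR_pos l0; have [k ->] := lsum_indic_nat (fun x => a < x) l.
have tw : INR i <= t * INR (size l) < INR i + 1.
  split.
    rewrite -[X in X <= _](_ : INR i / INR (size l) * INR (size l) = INR i); last by field; lra.
    by apply: Rmult_le_compat_r; lra.
  rewrite -[X in _ < X](_ : (INR i + 1) / INR (size l) * INR (size l) = INR i + 1); last by field; lra.
  by apply: Rmult_lt_compat_r; lra.
have kw : INR k / INR (size l) * INR (size l) = INR k by field; lra.
split=> H.
  apply: (Rmult_lt_reg_r (INR (size l))) => //; rewrite kw.
  have : INR i + 1 <= INR k by rewrite -S_INR; apply: le_INR; move/INR_lt: H; lia.
  lra.
have : t * INR (size l) < INR k by rewrite -kw; apply: Rmult_lt_compat_r.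
lra.
Qed.

Lemma quantile_nonincreasing t t' : 0 <= t < 1 -> 0 <= t' < 1 -> t <= t' ->
  quantile l t' <= quantile l t.
Proof.
move=> t01 t01' tt'; apply: Rnot_lt_le => /quantile_gt H.
by have := proj2 (quantile_gt (quantile l t) t01); have := H t01'; lra.
Qed.

End Quantile.

(** * The limit quantile function *)

Section LimitQuantile.
Import Coquelicot.Coquelicot.
Local Open Scope R_scope.

(** For a < b, a continuous function between the indicators of ]b, +oo[ and ]a, +oo[. *)
Definition ramp (a b x : R) : R := (hinge a x - hinge b x) / (b - a).

Lemma ramp_continuity a b : continuity (ramp a b).
Proof.
apply: (continuity_mult (fun x => hinge a x - hinge b x) (fun=> / (b - a))).
  by apply: continuity_minus; exact: hinge_continuity.
by apply: continuity_const.
Qed.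

Lemma ramp_le a b x : a < b -> ramp a b x <= indic (fun y => a < y) x.
Proof.
move=> ab; apply: (Rmult_le_reg_r (b - a)); first lra.
have -> : ramp a b x * (b - a) = hinge a x - hinge b x by rewrite /ramp; field; lra.
have [ax|xa] := Rlt_le_dec a x.
  by rewrite indic_true // /hinge /Rmax; case: Rle_dec; case: Rle_dec; lra.
by rewrite indic_false ?/hinge; [rewrite !Rmax_right; lra | lra].
Qed.

Lemma ramp_ge a b x : a < b -> indic (fun y => b < y) x <= ramp a b x.
Proof.
move=> ab; apply: (Rmult_le_reg_r (b - a)); first lra.
have -> : ramp a b x * (b - a) = hinge a x - hinge b x by rewrite /ramp; field; lra.
have [bx|xb] := Rlt_le_dec b x.
  by rewrite indic_true // /hinge /Rmax; case: Rle_dec; case: Rle_dec; lra.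
by rewrite indic_false ?/hinge; [rewrite (Rmax_right (x - b)); [have := Rmax_r (x - a) 0; lra | lra] | lra].
Qed.

Variables (s : nat -> seq R) (C : R) (N0 : nat).
Hypothesis C0 : 0 < C.
Hypothesis s_neq0 : forall n, (N0 <= n)%N -> s n <> [::].
Hypothesis s_bound : forall n, (N0 <= n)%N -> {in s n, forall x, Rabs x <= C}.
Hypothesis s_desc : forall n, (N0 <= n)%N -> descending (s n).
Hypothesis s_cv : forall phi, continuity phi -> cvmean s phi.

(** [Q t] is the supremum of the levels whose limiting tail exceeds [t]. The lower limit of the
    quantiles at [t] is at least [Q t], and their upper limit is at most [Q t0] for each t0 in [0,
    t[; so convergence can fail only where [Q] jumps on the left. *)
Lemma limit_quantile : exists Q : R -> R,
  [/\ forall t, Rabs (Q t) <= C, forall t t', t <= t' -> Q t' <= Q t &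
      forall t, 0 < t < 1 -> Un_cv (fun n => quantile (s n) t) (Q t) \/
        exists2 e, 0 < e & forall t0, 0 <= t0 < t -> Q t + e <= Q t0].
Proof.
have /choice[L HL] : forall p : R * R, exists l, Un_cv (fun n => mean (s n) (ramp p.1 p.2)) l.
  by move=> p; apply: s_cv; exact: ramp_continuity.
(* Tails themselves need not converge, so a ramp from [a] to some larger [b] stands for the tail at
   [a]. The value - C makes the set nonempty, and a <= C bounds it. *)
pose S t a := a = - C \/ (a <= C /\ exists2 b, a < b & t < L (a, b)).
have /choice[Q HQ] : forall t, exists l, is_lub (S t) l.
  move=> t; have [||l Hl] := completeness (S t); last by exists l.
    by exists C => a [->|[]//]; lra.
  by exists (- C); left.
have QC t : - C <= Q t <= C.
  by have [ub lub] := HQ t; split; [apply: ub; left | apply: lub => a [->|[]//]; lra].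
have Qmono t t' : t <= t' -> Q t' <= Q t.
  move=> tt'; have [ub _] := HQ t; have [_ lub] := HQ t'; apply: lub => a [->|[aC [b ab Hb]]].
    by apply: ub; left.
  by apply: ub; right; split=> //; exists b => //; lra.
exists Q; split=> [t||t t01]; [exact: Rabs_le | exact: Qmono |].
have below a : a < Q t -> exists N, forall n, (N <= n)%N -> a < quantile (s n) t.
  move=> aQ; have [a' Sa' aa'] : exists2 a', S t a' & a < a'.
    apply: contrapT => H; have [_ lub] := HQ t.
    suff : Q t <= a by lra.
    by apply: lub => a' Sa'; apply: Rnot_lt_le => aa'; apply: H; exists a'.
  case: Sa' => [a'E|[a'C [b ab tL]]].
    exists N0 => n Hn.
    have /(s_bound Hn)/Rabs_le_between : quantile (s n) t \in s n.
      by apply: quantile_mem; [exact: s_neq0 | exact: s_desc | lra].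
    lra.
  have e0 : 0 < L (a', b) - t by lra.
  have [N HN] := HL (a', b) _ e0; exists (N + N0)%N => n Hn.
  have n0 : (N0 <= n)%N by lia.
  have nN : (N <= n)%coq_nat by lia.
  have /Rabs_lt_between H := HN n nN.
  apply: (Rlt_trans _ a') => //; apply/quantile_gt; [exact: s_neq0 | exact: s_desc | lra |].
  apply: (Rlt_le_trans _ (mean (s n) (ramp a' b))); first by move: H => /=; lra.
  by apply: mean_le => x _; exact: ramp_le.
have above t0 a : 0 <= t0 < t -> Q t0 < a ->
    exists N, forall n, (N <= n)%N -> quantile (s n) t <= a.
  move=> t0t Qa; have [aC|Ca] := Rle_lt_dec a C; last first.
    exists N0 => n Hn.
    have /(s_bound Hn)/Rabs_le_between : quantile (s n) t \in s n.
      by apply: quantile_mem; [exact: s_neq0 | exact: s_desc | lra].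
    lra.
  pose a0 := (Q t0 + a) / 2.
  have a0a : Q t0 < a0 < a by rewrite /a0; lra.
  have LL : L (a0, a) <= t0.
    apply: Rnot_lt_le => H; have [ub _] := HQ t0.
    suff : a0 <= Q t0 by lra.
    by apply: ub; right; split; [lra | exists a => //; lra].
  have e0 : 0 < t - L (a0, a) by lra.
  have [N HN] := HL (a0, a) _ e0; exists (N + N0)%N => n Hn.
  have n0 : (N0 <= n)%N by lia.
  have nN : (N <= n)%coq_nat by lia.
  have /Rabs_lt_between H := HN n nN.
  apply: Rnot_lt_le => /quantile_gt H'.
  have : t < mean (s n) (indic (fun x => a < x)).
    by apply: H'; [exact: s_neq0 | exact: s_desc | lra].
  have : mean (s n) (indic (fun x => a < x)) <= mean (s n) (ramp a0 a).
    by apply: mean_le => x _; apply: ramp_ge; lra.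
  by move: H => /=; lra.
have [H|H] := pselect (exists2 e, 0 < e & forall t0, 0 <= t0 < t -> Q t + e <= Q t0).
  by right.
left=> eps e0; have e2 : 0 < eps / 2 by lra.
have [t0 t0t Qt0] : exists2 t0, 0 <= t0 < t & Q t0 < Q t + eps / 2.
  apply: contrapT => H'; apply: H; exists (eps / 2) => // t0 t0t.
  by apply: Rnot_lt_le => ?; apply: H'; exists t0.
have [N1 H1] := below (Q t - eps / 2) ltac:(lra).
have [N2 H2] := above t0 _ t0t Qt0.
exists (N1 + N2)%N => n Hn; apply/Rabs_lt_between.
by have := H1 n ltac:(lia); have := H2 n ltac:(lia); lra.
Qed.

End LimitQuantile.

(** * The limit measure and its integrals *)

Section LimitMeasure.
Import mathcomp.classical.all_classical mathcomp.reals.all_reals.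
Import mathcomp.analysis.all_analysis mathcomp.analysis.measurable_realfun.
Local Open Scope classical_set_scope.
Local Open Scope ring_scope.

Let RT : realType := R.
Local Notation D := (`[0%R, 1%R[%classic : set RT).

Lemma is_borel_measurable (A : R -> Prop) : is_borel A -> measurable (A : set RT).
Proof.
elim=> {A} [A oA|A _ IH|A _ IH].
- apply: elementary_open_measurable => x /oA[[d d0] Hd].
  exists d; first exact/RltP.
  by move=> y /RltP yx; apply: Hd; rewrite /disc /= RabsE.
- exact: measurableC.
- rewrite (_ : (fun x => _) = \bigcup_k (A k : set RT)); first exact: bigcupT_measurable.
  by apply/seteqP; split=> x [k]; exists k.
Qed.

Lemma continuity_bounded_measurable (phi : R -> R) : continuity phi ->
  (exists B, forall x, Rle 0 (phi x) /\ Rle (phi x) B) -> bounded_measurable (R := RT) phi.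
Proof.
move=> cphi [B HB]; split.
  apply: superlevel_measurable => r.
  rewrite (_ : mkset _ = (fun x => Rle r (phi x))).
    by apply: is_borel_measurable; exact: is_borel_superlevel.
  by apply/seteqP; split=> x /= /RleP.
exists B => x; have [/RleP p0 /RleP pB] := HB x.
by rewrite ger0_norm.
Qed.

Lemma indic_set (A : R -> Prop) : Defs.indic A = \1_(A : set RT) :> (R -> R).
Proof.
apply: funext => x; rewrite indicE; have [Ax|nAx] := pselect (A x).
  by rewrite indic_true // mem_set.
by rewrite indic_false // memNset.
Qed.

Lemma lsum_big (phi : R -> R) (l : seq R) : lsum phi l = \sum_(x <- l) phi x.
Proof. by elim: l => [|x l IH] /=; rewrite ?big_nil // big_cons IH. Qed.

Lemma expect_quantile (l : seq R) (phi : R -> R) : l <> [::] -> descending l ->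
  bounded_measurable (R := RT) phi -> expect (R := RT) (quantile l) phi = mean l phi.
Proof.
move=> l0 dl bphi; rewrite /mean lsum_big (big_nth 0) big_mkord RdivE INRE.
apply: expect_step => //; last 2 first.
- by case: (l) l0.
- move=> i t il /RleP it /RltP ti; apply: quantile_nth => //; split.
    by rewrite RdivE !INRE.
  by rewrite RdivE !INRE -[X in (i%:R + X)%coqR]/(1 : R) RplusE natr1.
apply: nonincreasing_on_measurable => s t /=; rewrite !in_itv /=.
move=> /andP[/RleP s0 /RltP s1] /andP[/RleP t0 /RltP t1] /RleP st.
by apply/RleP; apply: quantile_nonincreasing.
Qed.

Section Push.
Variable Q : R -> R.
Hypothesis Qmono : forall t t', Rle t t' -> Rle (Q t') (Q t).

Let mQ : measurable_fun D (Q : RT -> RT).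
Proof.
by apply: nonincreasing_on_measurable => s t _ _ /RleP st; apply/RleP; exact: Qmono.
Qed.

Definition limit_nu (A : R -> Prop) : R := lebesgue_push (R := RT) Q A.

Lemma limit_nu_probability : probability_measure limit_nu.
Proof.
split; last first.
  by rewrite -[RHS](lebesgue_pushT Q); congr lebesgue_push; apply/seteqP.
split=> [A _|]; first by apply/RleP; exact: lebesgue_push_ge0.
split.
  by rewrite -[RHS](lebesgue_push0 Q); congr lebesgue_push; apply/seteqP.
move=> A bA dA eps /RltP e0.
have [N HN] := lebesgue_push_sigma_additive mQ (fun k => is_borel_measurable (bA k)) dA e0.
exists N => n nN; rewrite RdistE sum_f_R0E; apply/RltP.
rewrite (_ : (fun x => exists k, A k x) = \bigcup_k (A k : set RT)); last first.
  by apply/seteqP; split=> x [k]; exists k.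
by apply: HN; lia.
Qed.

Definition good (sf : seq (R * (R -> Prop))) : Prop :=
  List.Forall (fun p => Rle 0 (fst p) /\ is_borel (snd p)) sf.

Lemma simple_eval_bounded_measurable sf : good sf ->
  bounded_measurable (R := RT) (simple_eval sf).
Proof.
elim: sf => [_|[c A] sf IH H]; first exact: bounded_measurable_cst.
inversion H as [|? ? [c0 bA] Hsf]; subst.
apply: (@bounded_measurable_lin RT c (Defs.indic A) (simple_eval sf)) => //.
  by rewrite indic_set; apply: bounded_measurable_indic; exact: is_borel_measurable.
exact: IH.
Qed.

Lemma expect_simple_eval sf : good sf ->
  expect (R := RT) Q (simple_eval sf) = simple_val limit_nu sf.
Proof.
elim: sf => [_|[c A] sf IH H]; first exact: expect_cst.
inversion H as [|? ? [c0 bA] Hsf]; subst; rewrite /= -/(simple_val _ _) -(IH Hsf).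
have mA := is_borel_measurable bA.
rewrite [LHS](@expect_lin RT Q mQ c (Defs.indic A) (simple_eval sf)).
- by rewrite indic_set expect_indic.
- by rewrite indic_set; exact: bounded_measurable_indic.
- exact: simple_eval_bounded_measurable.
Qed.

Lemma limit_nu_integral phi : cont_compact_support phi ->
  Defs.integral limit_nu phi (Rminus (expect (R := RT) Q (fun x => Rmax (phi x) 0))
                                (expect (R := RT) Q (fun x => Rmax (- phi x) 0))).
Proof.
apply: (integral_functional (E := expect (R := RT) Q)).
- by move=> sf; exact: expect_simple_eval.
- move=> sf psi gsf cpsi bpsi le; apply/RleP; apply: expect_le => //.
  + exact: simple_eval_bounded_measurable.
  + exact: continuity_bounded_measurable.
  + by move=> x; apply/RleP.
- move=> sf psi eps gsf cpsi bpsi e0 le; apply/RleP.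
  have bs := simple_eval_bounded_measurable gsf.
  have bc := bounded_measurable_cst (R := RT) eps.
  rewrite RplusE -[X in X + eps]mul1r -[X in _ + X](expect_cst Q eps) -expect_lin //.
  apply: expect_le => //; [exact: continuity_bounded_measurable | exact: bounded_measurable_lin |].
  by move=> x; rewrite mul1r; apply/RleP.
Qed.

End Push.

Variables (s : nat -> seq R) (C : R) (N0 : nat).
Hypothesis C0 : Rlt 0 C.
Hypothesis s_neq0 : forall n, (N0 <= n)%N -> s n <> [::].
Hypothesis s_bound : forall n, (N0 <= n)%N -> {in s n, forall x, Rle (Rabs x) C}.
Hypothesis s_desc : forall n, (N0 <= n)%N -> descending (s n).
Hypothesis s_cv : forall phi, continuity phi -> cvmean s phi.

(** The points of ]0, 1[ without convergence are jumps of the nonincreasing [Q]. A rational is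
    chosen inside each jump; jumps at different points are disjoint, so these rationals are distinct
    and the points are countable. *)
Lemma expect_limit (Q : R -> R) (phi : R -> R) :
  (forall t t', Rle t t' -> Rle (Q t') (Q t)) ->
  (forall t, Rlt 0 t /\ Rlt t 1 -> Un_cv (fun n => quantile (s n) t) (Q t) \/
     exists2 e, Rlt 0 e & forall t0, Rle 0 t0 /\ Rlt t0 t -> Rle (Rplus (Q t) e) (Q t0)) ->
  continuity phi -> (exists B, forall x, Rle 0 (phi x) /\ Rle (phi x) B) ->
  Un_cv (fun n => mean (s n) phi) (expect (R := RT) Q phi).
Proof.
move=> Qmono Qcv cphi bphi; have bm := continuity_bounded_measurable cphi bphi.
pose bad t := [/\ Rlt 0 t, Rlt t 1 & ~ Un_cv (fun n => quantile (s n) t) (Q t)].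
have gap t : exists r : rat, bad t -> Rlt (Q t) (ratr r) /\
    forall t0, Rle 0 t0 -> Rlt t0 t -> Rlt (ratr r) (Q t0).
  have [[t0 t1 ncv]|nb] := pselect (bad t); last by exists 0 => /nb.
  have [//|[e e0 He]] := Qcv t (conj t0 t1).
  have Qe : Q t < Q t + e by rewrite ltrDl; apply/RltP.
  have [r] := rat_in_itvoo Qe; rewrite in_itv /= => /andP[/RltP Qr /RltP rQ].
  exists r => _; split=> // u u0 ut.
  by apply: Rlt_le_trans rQ _; apply: He.
have [r Hr] := choice gap.
have rinj t t' : bad t -> bad t' -> Rlt t t' -> r t <> r t'.
  move=> bt bt' tt' rr; have [t0 _ _] := bt.
  have [H1 _] := Hr t bt; have [_ H2] := Hr t' bt'.
  have := H2 t (Rlt_le _ _ t0) tt'; rewrite -rr => H3.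
  exact: Rlt_irrefl (Rlt_trans _ _ _ H1 H3).
(* The point 0 is added because convergence is discussed on ]0, 1[ only; the successor in the code
   reserves 0 for it. *)
have cZ : countable ([set t | bad t \/ t = 0] : set RT).
  apply/countable_injP.
  exists (fun t : R => if t == 0 then 0%N else (choice.pickle (r t)).+1) => t t'.
  rewrite !inE /=; have [->|t0] := eqVneq t 0; have [->//|t0'] := eqVneq t' 0 => //.
  case=> [bt|/eqP]; last by rewrite (negbTE t0).
  case=> [bt'|/eqP]; last by rewrite (negbTE t0').
  move=> /succn_inj/(pcan_inj choice.pickleK) rr.
  by have [tt'|[//|tt']] := Rtotal_order t t'; [case: (rinj t t')|case: (rinj t' t)].
have mQ : measurable_fun D (Q : RT -> RT).
  by apply: nonincreasing_on_measurable => u t _ _ /RleP ut; apply/RleP; exact: Qmono.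
(* The shift by [N0] makes every list nonempty and descending, hence every quantile function
   monotone. *)
have mqn n : measurable_fun D (quantile (s (n + N0)%N) : RT -> RT).
  apply: nonincreasing_on_measurable => u t /=; rewrite !in_itv /=.
  move=> /andP[/RleP u0 /RltP u1] /andP[/RleP t0 /RltP t1] /RleP ut.
  by apply/RleP; apply: quantile_nonincreasing => //; [apply: s_neq0|apply: s_desc]; lia.
move=> eps /RltP e0.
have [||N HN] := @expect_cvg RT _ _ _ _ mqn mQ bm cZ _ eps => //.
  move=> t /=; rewrite in_itv /= => /andP[/RleP t0 /RltP t1] nZ e /RltP ep.
  have t0' : Rlt 0 t by case: t0 => // t0; case: nZ; right.
  have cv : Un_cv (fun n => quantile (s n) t) (Q t).
    by apply: contrapT => ncv; apply: nZ; left.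
  have [d [dp Hd]] := cphi (Q t) e ep.
  have [N HN] := cv d dp; exists N => n Nn; rewrite -RabsE; apply/RltP.
  have [->|ne] := Req_EM_T (quantile (s (n + N0)%N) t) (Q t).
    by rewrite subrr Rabs_R0.
  apply: Hd; split; first by split=> //; exact: nesym.
  by apply: HN; lia.
exists (N + N0)%N => n Hn; have := HN (n - N0)%N.
rewrite subnK; last by lia.
rewrite expect_quantile //; [|apply: s_neq0; lia|apply: s_desc; lia].
by rewrite RdistE => H; apply/RltP; apply: H; lia.
Qed.

Theorem limit_measure : exists2 nu, probability_measure nu &
  forall phi, cont_compact_support phi -> exists2 v, Defs.integral nu phi v &
    Un_cv (fun n => Rminus (mean (s n) (fun x => Rmax (phi x) 0))
                           (mean (s n) (fun x => Rmax (- phi x) 0))) v.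
Proof.
have [Q [_ Qmono Qcv]] := limit_quantile C0 s_neq0 s_bound s_desc s_cv.
exists (limit_nu Q); first exact: limit_nu_probability.
move=> phi Hphi; have [B HB] := compact_support_bounded Hphi; have [cphi _] := Hphi.
have bnd psi : (forall x, Rle (Rabs (psi x)) B) ->
    exists B, forall x, Rle 0 (Rmax (psi x) 0) /\ Rle (Rmax (psi x) 0) B.
  move=> Hpsi; exists B => x; split; first exact: Rmax_r.
  apply: Rmax_lub; first exact: Rle_trans (Rle_abs _) (Hpsi x).
  exact: Rle_trans (Rabs_pos _) (Hpsi x).
eexists; first exact: limit_nu_integral.
apply: CV_minus; apply: expect_limit => //.
- exact: pos_part_continuity.
- exact: bnd.
- by apply: (pos_part_continuity (phi := fun x => Ropp (phi x))); exact: continuity_opp.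
- by apply: bnd => x; rewrite Rabs_Ropp.
Qed.

End LimitMeasure.

(** * Sorted lists of points and rescaling *)

Section EmpiricalPoints.
Local Open Scope R_scope.

Definition descending_sort (l : seq R) : seq R := sort (fun x y => (y <= x)%O) l.

Lemma descending_sortP l : descending (descending_sort l).
Proof.
move=> i j ij js; apply/RleP.
have tot : total (fun x y : R => (y <= x)%O) by move=> x y; exact: le_total.
have tr : transitive (fun x y : R => (y <= x)%O) by move=> x y z xy yz; exact: le_trans yz xy.
have refl : reflexive (fun x y : R => (y <= x)%O) by move=> x; exact: lexx.
apply: (sorted_leq_nth tr refl 0 (sort_sorted tot l)) => //; rewrite inE //.
exact: leq_ltn_trans ij js.
Qed.

Lemma mean_descending_sort l phi : mean (descending_sort l) phi = mean l phi.
Proof.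
rewrite /mean !lsum_big size_sort (perm_big l) //=.
by rewrite perm_sort.
Qed.

Lemma descending_sort_neq0 l : l <> [::] -> descending_sort l <> [::].
Proof. by move=> l0 /(congr1 size); rewrite size_sort => /size0nil. Qed.

Lemma mean_indic_count (l : seq R) (P : pred R) (A : R -> Prop) :
  (forall x, A x <-> P x) -> mean l (indic A) = INR (count P l) / INR (size l).
Proof.
move=> AP; rewrite /mean; congr (_ / _); elim: l => //= x l ->.
case: (boolP (P x)) => Px.
  by rewrite indic_true; [rewrite add1n S_INR; ring | exact/AP].
by rewrite indic_false; [rewrite add0n; ring | move=> /AP; rewrite (negbTE Px)].
Qed.

Lemma Un_cv_eventually_eq (u v : nat -> R) (l : R) N :
  (forall n, (N <= n)%N -> u n = v n) -> Un_cv u l -> Un_cv v l.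
Proof.
move=> uv ul eps /ul[M HM]; exists (M + N)%N => n Hn; rewrite -uv; last by lia.
by apply: HM; lia.
Qed.

Lemma Tscale_probability mu c : 0 < c -> probability_measure mu ->
  probability_measure (Tscale c mu).
Proof.
move=> c0 [[pos [mu0 sigma]] mu1]; split=> //; split; last split=> //.
  by move=> A bA; apply: pos; exact: is_borel_scale.
move=> A bA dA; apply: (sigma (fun k x => A k (c * x))) => [k|i j x].
  exact: is_borel_scale.
exact: dA.
Qed.

End EmpiricalPoints.

(** * The rescaled measures as empirical measures *)

Section RescaledMeasures.
Local Open Scope R_scope.
Variables (K : fieldType) (V : lmodType K) (Mg : Z -> Z -> V -> Prop).
Variables (degs : nat -> seq Z) (nus : nat -> (R -> Prop) -> R).
Hypothesis Hrow : forall n, has_dim (row_space Mg (Z.of_nat n)) (size (degs n)).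
Hypothesis Hfilt : forall n r, has_dim (filt_space Mg (Z.of_nat n) r)
  (count (fun d => `[< r <= IZR d >]) (degs n)).
Hypothesis Hnus : forall n : nat, le 1 n -> nu_of Mg (Z.of_nat n) (nus n).

Definition points (n : nat) : seq R := descending_sort (rescaled degs n).

Lemma Tscale_nu_zero k : degs k.+1 = [::] ->
  forall A, Tscale (1 / INR k.+1) (nus k.+1) A = 0.
Proof.
move=> d0 A; have [|w [Hw [H0 _]]] := @Hnus k.+1; first by lia.
by apply: H0; have := has_dim_uniq Hw (Hrow k.+1); rewrite d0.
Qed.

Lemma Tscale_nu_empirical k : degs k.+1 <> [::] ->
  forall A, is_borel A -> Tscale (1 / INR k.+1) (nus k.+1) A = mean (points k.+1) (indic A).
Proof.
move=> d0.
have n0 : 0 < INR k.+1 by apply: lt_0_INR; lia.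
have [|w [Hw [_ H1]]] := @Hnus k.+1; first by lia.
have wE : w = size (degs k.+1) := has_dim_uniq Hw (Hrow k.+1).
have w0 : w <> 0%N by rewrite wE => /size0nil.
have [prob ray] := H1 w0.
have c0 : 0 < 1 / INR k.+1 by apply: Rdiv_lt_0_compat; lra.
apply: empirical_measureE; first exact: Tscale_probability.
  apply: descending_sort_neq0; rewrite /rescaled; by case: (degs k.+1) d0.
move=> r; rewrite /points mean_descending_sort.
(* A ray of the rescaled measure is a ray of the original one, whose mass the filtration
   prescribes. *)
have -> : Tscale (1 / INR k.+1) (nus k.+1) (fun x => r <= x) =
    nus k.+1 (fun x => r * INR k.+1 <= x).
  rewrite /Tscale; congr (nus _ _); apply: pred_ext => x; split=> H.
    have -> : x = 1 / INR k.+1 * x * INR k.+1 by field; lra.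
    by apply: Rmult_le_compat_r; lra.
  have -> : r = 1 / INR k.+1 * (r * INR k.+1) by field; lra.
  by apply: Rmult_le_compat_l; lra.
rewrite (ray _ _ (Hfilt k.+1 (r * INR k.+1))) wE.
rewrite (@mean_indic_count _ (fun x => `[< r <= x >])); last by move=> x; split=> /asboolP.
rewrite /rescaled size_map count_map; congr (INR _ / _).
move: (INR k.+1) n0 => c n0.
apply: eq_count => d /=; apply/asboolP/asboolP => H.
  have -> : r = r * c / c by field; lra.
  by apply: Rmult_le_compat_r => //; apply/Rlt_le/Rinv_0_lt_compat.
have -> : IZR d = IZR d / c * c by field; lra.
by apply: Rmult_le_compat_r; lra.
Qed.

Lemma Tscale_nu_integral k phi : cont_compact_support phi ->
  integral (Tscale (1 / INR k.+1) (nus k.+1)) phi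
    (if degs k.+1 is [::] then 0 else
     mean (points k.+1) (fun x => Rmax (phi x) 0) - mean (points k.+1) (fun x => Rmax (- phi x) 0)).
Proof.
move=> Hphi; case E : (degs k.+1) => [|d l]; first exact: zero_integral (Tscale_nu_zero E) Hphi.
have d0 : degs k.+1 <> [::] by rewrite E.
apply: empirical_integral => //; last exact: Tscale_nu_empirical.
by apply: descending_sort_neq0; rewrite /rescaled E.
Qed.

End RescaledMeasures.

Open Scope R_scope.

Theorem mainTheorem19 (K : fieldType) (V : lmodType K) (m : nat)
    (f : 'I_m -> nat * nat) (T : 'I_m -> V -> V) (Mg : Z -> Z -> V -> Prop)
    (Hf1 : forall i, (f i).1 = 1%nat)
    (HM : is_bigraded_module f T Mg)
    (Hfg : is_finitely_generated T)
    (nus : nat -> (R -> Prop) -> R)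
    (Hnus : forall n : nat, le 1 n -> nu_of Mg (Z.of_nat n) (nus n)) :
  let sc := fun k : nat => Tscale (1 / INR (S k)) (nus (S k)) in
  exists nu : (R -> Prop) -> R,
    borel_measure nu /\ vague_cv sc nu /\
    ((exists N : nat, forall n : nat, le N n ->
        exists v : V, row_space Mg (Z.of_nat n) v /\ v <> GRing.zero) ->
     probability_measure nu /\
     exists g : R -> R, concave_on01 g /\
       forall eps : R, eps > 0 -> exists N : nat, forall k : nat, le N k ->
         forall t : R, 0 <= t <= 1 -> Rabs (polygon (sc k) t - g t) < eps).
Proof.
move=> sc; have [degs [Hrow Hfilt [C HC] Hmom]] := degree_lists Hf1 HM Hfg.
have Hint k phi := @Tscale_nu_integral K V Mg degs nus Hrow Hfilt Hnus k phi.
have [[N HN]|[[N HN] Hcv]] := rescaled_dichotomy HC Hmom.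
  exists (fun=> 0); split; last split.
  - split; first by move=> *; exact: Rle_refl.
    split=> // A _ _ eps e0; exists 0%N => n _.
    have -> : sum_f_R0 (fun=> 0) n = 0 by elim: n => //= n ->; ring.
    by rewrite /Rdist Rminus_diag Rabs_R0.
  - move=> phi Hphi; exists 0; split; first exact: zero_integral.
    eexists; split; first by move=> k; exact: Hint Hphi.
    move=> eps e0; exists N => n Hn; rewrite HN; last by lia.
    by rewrite /Rdist Rminus_diag Rabs_R0.
  (* A row of dimension 0 contains no nonzero vector. *)
  - move=> [M HM']; have [v [Hv v0]] := HM' (M + N)%N ltac:(lia).
    have := Hrow (M + N)%N; rewrite HN; last by lia.
    move=> [b [_ [_ /(_ v Hv)[c]]]]; rewrite big_ord0 => vE; by case: v0.
(* Index [k] stands for row k + 1, as in [sc]. *)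
pose s k := points degs k.+1.
(* [C] might not be positive, whereas the approximation interval [-B, B] must have positive
   length. *)
pose B := Rmax (IZR C) 1.
have B0 : 0 < B by apply: Rlt_le_trans (Rmax_r _ _); lra.
have dneq k : (N <= k)%N -> degs k.+1 <> [::] by move=> Hk; apply: HN; lia.
have s_neq0 k : (N <= k)%N -> s k <> [::].
  move=> /dneq d0; apply: descending_sort_neq0; rewrite /rescaled; by case: (degs k.+1) d0.
have s_bound k : (N <= k)%N -> {in s k, forall x, Rabs x <= B}.
  move=> _ x; rewrite mem_sort => /(rescaled_bound HC) H.
  by apply: Rle_trans (H _) (Rmax_l _ _).
have s_desc k : (N <= k)%N -> descending (s k) by move=> _; exact: descending_sortP.
have s_mom j : exists l, Un_cv (fun k => mean (s k) (fun x => x ^ j)) l.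
  have [l Hl] := Hcv j; exists l => eps /Hl[M HM']; exists M => n Hn.
  by rewrite /s mean_descending_sort; apply: HM'; lia.
have s_cv phi : continuity phi -> cvmean s phi.
  exact: (cvmean_continuous B0 s_neq0 s_bound s_mom).
have sE k : (N <= k)%N -> forall A, is_borel A -> sc k A = mean (s k) (indic A).
  by move=> /dneq d0; exact: (Tscale_nu_empirical Hrow Hfilt Hnus).
have [nu nu_prob nu_int] := limit_measure B0 s_neq0 s_bound s_desc s_cv.
exists nu; split; [exact: nu_prob.1|split].
- move=> phi Hphi; have [v Hv cv] := nu_int phi Hphi; exists v; split=> //.
  eexists; split; first by move=> k; exact: Hint Hphi.
  apply: Un_cv_eventually_eq cv => k /dneq.
  by case: (degs k.+1).
- move=> _; split=> //; apply: (polygons_cv B0 s_neq0 s_bound s_desc s_cv).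
  by move=> k Hk a; apply: sE => //; exact: is_borel_gt.
Qed.
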